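(* Consider the sparse additive logistic model $Y\mid(\mathbf X=\mathbf x)\sim B(1,p(\mathbf x))$ with logit $g=\ln\frac{p}{1-p}\in\mathcal G_{\mathcal B}(d_0,\mathbf s,\mathbf p,\mathbf q)$, where $d_0\ln\left(\frac{de}{d_0}\right)\le n$. Then $$\inf_{\widetilde\eta}\ \sup_{\eta^*\in\mathcal C_{\mathcal B}(d_0,\mathbf s,\mathbf p,\mathbf q),\,\mathbb P_X}\mathcal E(\widetilde\eta,\eta^* )\ \ge\ \tilde C\sqrt{\frac{d_0\ln\left(\frac{de}{d_0}\right)}{n}+\sum_{j\in\mathcal J}n^{-\frac{2s_j}{2s_j+1}}}$$ for some constant $\tilde C>0$, where the infimum is taken over all classifiers $\widetilde\eta$ based on the data $(\mathbf X_1,Y_1),\dots,(\mathbf X_n,Y_n)$.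
   Context: Model. $\mathbf X\in\mathbb R^d$ is a vector of linearly independent features with marginal distribution $\mathbb P_X$ supported on a bounded set $\mathcal X\subseteq[0,1]^d$; $Y\in\{0,1\}$ with $P(Y=1\mid\mathbf X=\mathbf x)=p(\mathbf x)$; the logit is $g(\mathbf x)=\ln\frac{p(\mathbf x)}{1-p(\mathbf x)}\in L_2(\mathcal X)$. The data $D=\{(\mathbf X_i,Y_i)\}_{i=1}^n$ are i.i.d. copies of $(\mathbf X,Y)$. For a classifier $\eta$, the (conditional) misclassification risk is $R(\eta)=P(Y\ne\eta(\mathbf X)\mid D)$. The Bayes classifier is $\eta^*(\mathbf x)=I\{p(\mathbf x)\ge1/2\}=I\{g(\mathbf x)\ge0\}$, and the misclassification excess risk of a data-based classifier $\widetilde\eta$ is $\mathcal E(\widetilde\eta,\eta^* )=\mathbb E R(\widetilde\eta)-R(\eta^* )$, the expectation being over $D$. Wavelet basis. Given a compactly supported scaling function $\phi$ of regularity $r$ and the corresponding mother wavelet $\psi$, one has an orthonormal wavelet basis on the unit interval (Cohen–Daubechies–Vial construction) with $\psi_{hk}(t)=2^{h/2}\psi(2^ht-k)$, $h\ge0$, $k=0,\dots,2^h-1$ (suitably adapted at the boundary), together with a coarse-scale basis function $\psi_0$. Function classes. For a univariate $g_j$ on $[0,1]$ put $\beta_{j,hk}=\int_0^1g_j(t)\psi_{hk}(t)\,dt$; because of the identifiability condition $\mathbb E g_j(X_j)=0$ the paper takes the coefficient of $\psi_0$ to be zero. The Besov class $B^{s_j}_{p_j,q_j}[0,1]$ of fixed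 radius $R_j>0$, where $1\le p_j,q_j\le\infty$ and $(\frac1{p_j}-\frac12)_+<s_j<r$, is (via its wavelet characterization) the set of $g_j$ with $$\sum_{h=0}^\infty\Big(2^{h(s_j+1/2-1/p_j)}\Big(\sum_{k=0}^{2^h-1}|\beta_{j,hk}|^{p_j}\Big)^{1/p_j}\Big)^{q_j}\le R_j,$$ with the $\ell_{p_j}$ and/or $\ell_{q_j}$ norms replaced by the $\ell_\infty$ norms if $p_j=\infty$ and/or $q_j=\infty$. For $1\le d_0\le d$, $$\mathcal G_{\mathcal B}(d_0,\mathbf s,\mathbf p,\mathbf q)=\Big\{g\in L_2(\mathcal X):\ g(\mathbf x)=\mu+\sum_{j\in\mathcal J}g_j(x_j),\ \mathcal J\subseteq\{1,\dots,d\},\ |\mathcal J|\le d_0,\ g_j\in B^{s_j}_{p_j,q_j}[0,1],\ \mathbb E g_j(X_j)=0,\ j\in\mathcal J\Big\},$$ where the active set $\mathcal J$ is unknown and ranges over all such subsets, and $\mathcal C_{\mathcal B}(d_0,\mathbf s,\mathbf p,\mathbf q)=\{\eta(\mathbf x)=I\{g(\mathbf x)\ge0\}:g\in\mathcal G_{\mathcal B}(d_0,\mathbf s,\mathbf p,\mathbf q)\}$. The supremum is over true logits $g\in\mathcal G_{\mathcal B}(d_0,\mathbf s,\mathbf p,\mathbf q)$ (with $\eta^*=I\{g\ge0\}$) and over marginal distributions $\mathbb P_X$. Indexing convention: $\mathbf s,\mathbf p,\mathbf q$ (each of length $d_0$) list the parameters of the (at most) $d_0$ active components, the active features being enumerated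 by $1,\dots,d_0$ (some components may vanish); $\sum_{j\in\mathcal J}$ in the bound is the sum over these $d_0$ smoothness parameters. Constants. $\tilde C$ is a generic positive constant not depending on $n,d,d_0$.
   Formalization: The theorem assumes that the sum of n^(-2s_j/(2s_j+1)) is at most a fixed B and the radii R_j at least a fixed rho > 0; the constant may depend on B, rho and the wavelets. Without the bound B the claim fails (d = d_0 = n, s_j = 1/2: right side of order n^(1/4), excess risk at most 1). *)

(* Defs.v *)
From HB Require Import structures.
From mathcomp Require Import all_boot all_order all_algebra.
From mathcomp Require Import all_classical all_reals all_analysis.

Set Implicit Arguments.
Unset Strict Implicit.
Unset Printing Implicit Defensive.
Import Order.TTheory GRing.Theory Num.Theory.
Import numFieldNormedType.Exports.
Local Open Scope classical_set_scope.
Local Open Scope ring_scope.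

Definition dilate {R : realType} (f : R -> R) (h : nat) (k : int) (t : R) : R :=
  Num.sqrt (2 ^+ h) * f (2 ^+ h * t - k%:~R).

Definition inner01 {R : realType} (f g : R -> R) : R :=
  \int[lebesgue_measure]_(t in `[0%R, 1%R]) (f t * g t).

(* Enumerates the integers -N+1, -N+2, ... *)
Definition shiftN (N i : nat) : int := i%:Z + 1 - N%:Z.

(* Compactly supported orthonormal scaling function phi of regularity r and its
   mother wavelet psi, in the normalization of Cohen, Daubechies and Vial:
   filter a on {-N+1, .., N}, supports in [-N+1, N], N vanishing moments. *)
Record scaling_wavelet {R : realType} (r N : nat) (phi psi : R -> R) : Prop :=
ScalingWavelet {
  scaling_size_gt0 : (0 < N)%N ;
  scaling_smooth : forall m t, (m < r)%N -> derivable (derive1n m phi) t 1 ;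
  scaling_smooth_cont : forall m, (m <= r)%N -> continuous (derive1n m phi) ;
  scaling_support : forall t, t < 1 - N%:R \/ N%:R < t -> phi t = 0 ;
  scaling_mass : \int[lebesgue_measure]_t (phi t) = 1 ;
  scaling_orthonormal : forall k : int,
    \int[lebesgue_measure]_t (phi t * phi (t - k%:~R)) = (k == 0)%:R ;
  scaling_filter : exists a : int -> R,
    (forall t, phi t = Num.sqrt 2 *
       \sum_(i < N.*2) a (shiftN N i) * phi (2 * t - (shiftN N i)%:~R)) /\
    (forall t, psi t = Num.sqrt 2 *
       \sum_(i < N.*2) (-1) ^ (shiftN N i) * a (1 - shiftN N i) *
                       phi (2 * t - (shiftN N i)%:~R)) ;
  wavelet_moments : forall m, (m < N)%N ->
    \int[lebesgue_measure]_t (t ^+ m * psi t) = 0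
}.

(* The space V_h of the multiresolution on [0, 1]: spanned by the phi_(h,k) with
   N <= k < 2^h - N and by the N left and N right edge functions, i.e. by the
   restrictions to [0, 1] of the sums over k <= N - 1 (resp. k >= 2^h - N) of
   c_k phi_(h,k) with c_k polynomial in k of degree < N. The sum below ranges
   over all the phi_(h,k) that do not vanish on ]0, 1[. *)
Definition interval_mra {R : realType} (N : nat) (phi : R -> R) (h : nat)
    (f : R -> R) : Prop :=
  exists (c : int -> R) (P Q : {poly R}),
  [/\ (size P <= N)%N /\ (size Q <= N)%N,
      forall k : int, k <= N%:Z - 1 -> c k = P.[k%:~R],
      forall k : int, (2 ^ h)%N%:Z - N%:Z <= k -> c k = Q.[k%:~R] &
      forall t : R, 0 <= t <= 1 ->
        f t = \sum_(i < 2 ^ h + N.*2 - 2)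
                c (shiftN N i) * dilate phi h (shiftN N i) t].

(* Wavelet basis of L2([0, 1]) of Cohen, Daubechies and Vial.  Only the values on
   [0, 1] of cdv_psi0 and of cdv_basis h k, for k < 2^h, are meaningful.  From the
   level cdv_coarse on, cdv_basis h spans the orthogonal complement of V_h in
   V_(h+1); below it, the functions, together with cdv_psi0, form an orthonormal
   basis of the coarsest space. *)
Record cdv_wavelets (R : realType) (r : nat) := CdvWavelets {
  cdv_size : nat ;
  cdv_coarse : nat ;
  cdv_scaling : R -> R ;
  cdv_mother : R -> R ;
  cdv_left : nat -> R -> R ;
  cdv_right : nat -> R -> R ;
  cdv_psi0 : R -> R ;
  cdv_basis : nat -> nat -> R -> R ;
  cdv_mother_wavelet : scaling_wavelet r cdv_size cdv_scaling cdv_mother ;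
  cdv_coarse_large : (cdv_size.*2 <= 2 ^ cdv_coarse)%N ;
  cdv_left_support : forall i t, (i < cdv_size)%N ->
    (cdv_size.*2)%:R - 1 < t -> cdv_left i t = 0 ;
  cdv_right_support : forall i t, (i < cdv_size)%N ->
    t < 1 - (cdv_size.*2)%:R -> cdv_right i t = 0 ;
  cdv_interior : forall h k t, (cdv_coarse <= h)%N ->
    (cdv_size <= k)%N -> (k + cdv_size < 2 ^ h)%N -> 0 <= t <= 1 ->
    cdv_basis h k t = dilate cdv_mother h k%:Z t ;
  cdv_left_edge : forall h i t, (cdv_coarse <= h)%N ->
    (i < cdv_size)%N -> 0 <= t <= 1 ->
    cdv_basis h i t = Num.sqrt (2 ^+ h) * cdv_left i (2 ^+ h * t) ;
  cdv_right_edge : forall h i t, (cdv_coarse <= h)%N ->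
    (i < cdv_size)%N -> 0 <= t <= 1 ->
    cdv_basis h (2 ^ h - i.+1)%N t =
      Num.sqrt (2 ^+ h) * cdv_right i (2 ^+ h * (t - 1)) ;
  cdv_psi0_mra : interval_mra cdv_size cdv_scaling cdv_coarse cdv_psi0 ;
  cdv_basis_mra : forall h k, (k < 2 ^ h)%N ->
    interval_mra cdv_size cdv_scaling (maxn cdv_coarse h.+1)
      (cdv_basis h k) ;
  cdv_psi0_norm : inner01 cdv_psi0 cdv_psi0 = 1 ;
  cdv_psi0_orth : forall h k, (k < 2 ^ h)%N ->
    inner01 cdv_psi0 (cdv_basis h k) = 0 ;
  cdv_orthonormal : forall h k h' k', (k < 2 ^ h)%N -> (k' < 2 ^ h')%N ->
    inner01 (cdv_basis h k) (cdv_basis h' k') = ((h == h') && (k == k'))%:R ;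
  cdv_complete : forall f : R -> R, measurable_fun [set: R] f ->
    lebesgue_measure.-integrable `[0%R, 1%R] (fun t => (f t ^+ 2)%:E) ->
    inner01 f cdv_psi0 = 0 ->
    (forall h k, (k < 2 ^ h)%N -> inner01 f (cdv_basis h k) = 0) ->
    {ae lebesgue_measure, forall t, 0 <= t <= 1 -> f t = 0}
}.

Definition ell_norm {R : realType} (p : \bar R) (m : nat) (a : nat -> R) : R :=
  match p with
  | r%:E => (\sum_(k < m) `|a k| `^ r) `^ r^-1
  | _ => \big[Num.max/0]_(k < m) `|a k|
  end.

(* 2^(h (s + 1/2 - 1/p)) ||beta_(h,.)||_p, where 1/p = 0 if p = +oo *)
Definition besov_level {R : realType} {r : nat} (W : cdv_wavelets R r)
    (s : R) (p : \bar R) (f : R -> R) (h : nat) : R :=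
  2 `^ (h%:R * (s + 2^-1 - fine p^-1%E)) *
  ell_norm p (2 ^ h) (fun k => inner01 f (cdv_basis W h k)).

(* Functions on [0, 1] are represented by functions on R, whose values outside
   [0, 1] are irrelevant.  The radius bounds the sum of the q-th powers, not its
   q-th root. *)
Definition besov_class {R : realType} {r : nat} (W : cdv_wavelets R r)
    (s : R) (p q : \bar R) (radius : R) : set (R -> R) :=
  [set f : R -> R | [/\ measurable_fun [set: R] f,
      lebesgue_measure.-integrable `[0%R, 1%R] (fun t => (f t ^+ 2)%:E),
      inner01 f (cdv_psi0 W) = 0 &
      match q with
      | u%:E => (\sum_(0 <= h <oo) (besov_level W s p f h `^ u)%:E
                   <= radius%:E)%E
      | _ => forall h, besov_level W s p f h <= radius
      end]].

(* Absolute continuity of the law of each X_j makes f(X_j) well defined for f in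
   a class of functions determined by Lebesgue integrals only. *)
Definition feature_law {R : realType} {d : nat}
    (PX : probability (d.-tuple R) R) : Prop :=
  [/\ PX [set x | forall j, 0 <= tnth x j <= 1] = 1%E,
      (forall a : 'I_d -> R,
         PX [set x | \sum_(j < d) a j * tnth x j = 0] = 1%E ->
         forall j, a j = 0) &
      forall j, (fun A : set R => PX [set x | A (tnth x j)])
                  `<< (lebesgue_measure : set R -> \bar R)].

(* [rank] enumerates the active features by 0, .., d0 - 1 and attaches to each of
   them its smoothness parameters. *)
Definition additive_class {R : realType} {r : nat} (W : cdv_wavelets R r)
    {d d0 : nat} (s : 'I_d0 -> R) (p q : 'I_d0 -> \bar R) (radius : 'I_d0 -> R)
    (PX : probability (d.-tuple R) R) : set (d.-tuple R -> R) :=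
  [set g | g \in Lfun PX 2%:E /\
    exists (mu : R) (J : {set 'I_d}) (rank : 'I_d -> 'I_d0)
           (gj : 'I_d -> R -> R),
    [/\ (#|J| <= d0)%N,
        {in J &, injective rank},
        (forall j, j \in J ->
           besov_class W (s (rank j)) (p (rank j)) (q (rank j))
             (radius (rank j)) (gj j)),
        (forall j, j \in J -> (fun x => gj j (tnth x j)) \in Lfun PX 1%E /\
           ('E_PX[fun x => gj j (tnth x j)] = 0)%E) &
        forall x, g x = mu + \sum_(j in J) gj j (tnth x j)]].

(* Q is the law of (X, Y) when X has law PX and Y given X = x is B(1, p(x)), with
   logit g. *)
Definition logistic_law {R : realType} {d : nat}
    (PX : probability (d.-tuple R) R) (g : d.-tuple R -> R)
    (Q : probability (d.-tuple R * bool)%type R) : Prop :=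
  exists p : d.-tuple R -> R,
  [/\ measurable_fun [set: d.-tuple R] p,
      (forall x, 0 < p x < 1),
      (forall x, g x = ln (p x / (1 - p x))) &
      forall (A : set (d.-tuple R)) (C : set bool), measurable A ->
        (Q (A `*` C) = \int[PX]_(x in A) bernoulli_prob (p x) C)%E].

Definition tcons {d} {T : measurableType d} (n : nat) (z : T * n.-tuple T) :
  n.+1.-tuple T := [tuple of z.1 :: z.2].

Lemma measurable_tcons {d} {T : measurableType d} (n : nat) :
  measurable_fun [set: T * n.-tuple T] (@tcons d T n).
Proof. exact: measurable_cons. Qed.

HB.instance Definition _ {d} {T : measurableType d} (n : nat) :=
  isMeasurableFun.Build _ _ _ _ (@tcons d T n) (@measurable_tcons d T n).

Fixpoint iid_law {d} {T : measurableType d} {R : realType}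
    (P : probability T R) (n : nat) : probability (n.-tuple T) R :=
  match n return probability (n.-tuple T) R with
  | 0 => dirac [tuple]
  | m.+1 => distribution (P \x iid_law P m)%E (@tcons d T m)
  end.

Definition risk {R : realType} {d : nat}
    (Q : probability (d.-tuple R * bool)%type R) (eta : d.-tuple R -> bool) :
  \bar R := Q [set z | z.2 != eta z.1].

Definition bayes {R : realType} {d : nat} (g : d.-tuple R -> R) :
  d.-tuple R -> bool := fun x => 0 <= g x.

Definition data_classifier (R : realType) (d n : nat) : Type :=
  {mfun (n.-tuple (d.-tuple R * bool) * d.-tuple R)%type >-> bool}.

Definition excess_risk {R : realType} {d n : nat}
    (Q : probability (d.-tuple R * bool)%type R) (g : d.-tuple R -> R)
    (eta : data_classifier R d n) : \bar R :=
  (\int[iid_law Q n]_D risk Q (fun x => eta (D, x)) - risk Q (bayes g))%E.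

Definition minimax_excess_risk {R : realType} {r : nat} (W : cdv_wavelets R r)
    (n d : nat) {d0 : nat} (s : 'I_d0 -> R) (p q : 'I_d0 -> \bar R)
    (radius : 'I_d0 -> R) : \bar R :=
  ereal_inf [set ereal_sup [set e | exists PX g Q,
      [/\ @feature_law R d PX,
          additive_class W s p q radius PX g,
          logistic_law PX g Q &
          e = excess_risk Q g eta]]
    | eta in [set: data_classifier R d n]].

(* Main.v *)
From HB Require Import structures.
Require Import Defs.
From mathcomp Require Import all_boot all_order all_algebra.
From mathcomp Require Import all_classical all_reals all_analysis.
From mathcomp Require Import measurable_realfun.
From mathcomp Require Import ring lra zify.

Set Implicit Arguments.
Unset Strict Implicit.
Unset Printing Implicit Defensive.
Import Order.TTheory GRing.Theory Num.Theory.
Import numFieldNormedType.Exports.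
Local Open Scope classical_set_scope.
Local Open Scope ring_scope.

(** The minimax risk is bounded below by a Bayes risk.  The features are taken
    independent and uniform on [0, 1], and the logit is random:
    [u = beta * \sum_i eps_i psi_(i, l_i)], where the coordinates [i] of a finite
    set [I] are independent, [eps_i] is 0 with probability 1/2 and a random sign
    otherwise, [l_i] is uniform among [L] values, and the [psi_(i, l)] are
    orthonormal functions of the features.  Put [sigma^2 = |I| beta^2].

    With [tau = 2 p - 1], the excess risk of a classifier voting [v = 1] or [-1]
    is the mean of [(|tau| - v tau) / 2] ([excess_riskE]).  Averaged over the
    random logit given the data and [x], it is at least half the difference
    between the mean of [|tau|] and the modulus of the posterior mean of [tau],
    whatever the vote ([averaged_loss_ge]).  Up to an error [u^2] the signal [tau]
    is [u / 2], so two estimates are needed.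

    - The mean of [|u|] is of order [sigma]: the second moment is
      [sigma^2 / 2] and, by symmetry of the signs, the fourth moment is
      [O(sigma^4)] ([fourth_moment], [normr_ge_poly]).
    - The posterior mean of [u] is a combination of the [psi_(i, l)] with
      coefficients depending on the data only.  By orthonormality, integrating
      over [x] leaves the sum of their squares, and each is controlled by the
      change of the likelihood when coordinate [i] is switched on.  That change
      is a chi-square distance, at most [(1 + beta^2)^n - 1]
      ([likelihood_chi2]), and each of the [L] candidates has a prior weight
      of order [1 / L]; altogether the second moment is at most
      [sigma^2 ((1 + beta^2)^n - 1) / (2 L)].

    Hence the excess risk is at least [sigma / (64 K)] as soon as [n beta^2] is a
    small multiple of [ln (e L)] and [sigma] is small ([random_logit_excess]); the
    constant [K] bounds [\sum_i psi_(i, l_i)^2 / |I|].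
    The logits are additive with components in the Besov balls when every
    [psi_(i, l)] is an interior wavelet of one feature, of small enough
    amplitude ([design_additive]); [design_minimax] is the resulting bound.

    Two designs give the two terms of the rate.

    - Sparsity ([sparse_minimax]): [d0] disjoint blocks of [L = d %/ d0] features
      and one fixed wavelet; each coordinate picks a feature of its block, and
      [beta^2] is of order [ln (e L) / n], so that [sigma^2] is of order
      [d0 ln (d e / d0) / n].
    - Smoothness ([smooth_minimax]): on each of [d0] given features, all the
      interior wavelets, spaced to have disjoint supports, at the resolution
      [2^h] of order [n^(1/(2s+1))], with [L = 1] and [beta^2] of order [1 / n], so
      that [sigma^2] is of order [\sum_j n^(-2 s_j / (2 s_j + 1))].

    The larger of the two bounds is of the order of the root of the sum.  The
    hypotheses that both terms are bounded keep [sigma] small. *)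

(** * Expectations of bounded measurable functions *)

Section bounded_measurable.
Context {d} {T : measurableType d} {R : realType}.
Implicit Types f g : T -> R.

(** All the functions integrated below are bounded and measurable.  The class is
    stable under the operations in use, so that real-valued means are linear
    and can be exchanged without integrability conditions. *)
Definition bounded_measurable f :=
  measurable_fun [set: T] f /\ exists M, forall x, `|f x| <= M.

Lemma eq_bm f g : f =1 g -> bounded_measurable f -> bounded_measurable g.
Proof. by move=> /funext ->. Qed.

Lemma bm_cst c : bounded_measurable (fun=> c).
Proof. by split; [exact: measurable_cst | exists `|c|]. Qed.

Lemma bmD f g : bounded_measurable f -> bounded_measurable g ->
  bounded_measurable (fun x => f x + g x).
Proof.
move=> [mf [M fM]] [mg [N gN]]; split; first exact: measurable_funD.
by exists (M + N) => x; rewrite (le_trans (ler_normD _ _))// lerD.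
Qed.

Lemma bmM f g : bounded_measurable f -> bounded_measurable g ->
  bounded_measurable (fun x => f x * g x).
Proof.
move=> [mf [M fM]] [mg [N gN]]; split; first exact: measurable_funM.
by exists (M * N) => x; rewrite normrM ler_pM.
Qed.

Lemma bmZ c f : bounded_measurable f -> bounded_measurable (fun x => c * f x).
Proof. exact/bmM/bm_cst. Qed.

Lemma bmN f : bounded_measurable f -> bounded_measurable (fun x => - f x).
Proof.
by move=> /(bmZ (-1)); apply: eq_bm => x; rewrite mulN1r.
Qed.

Lemma bmB f g : bounded_measurable f -> bounded_measurable g ->
  bounded_measurable (fun x => f x - g x).
Proof. by move=> bf /bmN; exact: bmD. Qed.

Lemma bmX f n : bounded_measurable f -> bounded_measurable (fun x => f x ^+ n).
Proof.
move=> bf; elim: n => [|n IH]; first exact: (bm_cst 1).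
by apply: eq_bm (bmM bf IH) => x; rewrite exprS.
Qed.

Lemma bm_norm f : bounded_measurable f -> bounded_measurable (fun x => `|f x|).
Proof.
move=> [mf [M fM]]; split; first exact: measurableT_comp.
by exists M => x; rewrite normr_id.
Qed.

Lemma bm_sum I (r : seq I) (Q : pred I) (F : I -> T -> R) :
  (forall i, Q i -> bounded_measurable (F i)) ->
  bounded_measurable (fun x => \sum_(i <- r | Q i) F i x).
Proof.
move=> bF; elim: r => [|i r IH].
  by apply: eq_bm (bm_cst _) => x; rewrite big_nil.
case Qi : (Q i).
  by apply: eq_bm (bmD (bF i Qi) IH) => x; rewrite big_cons Qi.
by apply: eq_bm IH => x; rewrite big_cons Qi.
Qed.

Lemma bm_prod I (r : seq I) (Q : pred I) (F : I -> T -> R) :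
  (forall i, Q i -> bounded_measurable (F i)) ->
  bounded_measurable (fun x => \prod_(i <- r | Q i) F i x).
Proof.
move=> bF; elim: r => [|i r IH].
  by apply: eq_bm (bm_cst _) => x; rewrite big_nil.
case Qi : (Q i).
  by apply: eq_bm (bmM (bF i Qi) IH) => x; rewrite big_cons Qi.
by apply: eq_bm IH => x; rewrite big_cons Qi.
Qed.

(** The inverse is measurable because it is [exp (- ln f)]. *)
Lemma bmV f (c : R) : 0 < c -> (forall x, c <= f x) -> measurable_fun setT f ->
  bounded_measurable (fun x => (f x)^-1).
Proof.
move=> c0 cf mf; split.
  rewrite (_ : (fun x => _) = fun x => expR (- ln (f x))).
    apply: (measurableT_comp (@measurable_expR R)).
    exact/measurable_funN/(measurableT_comp (@measurable_ln R)).
  by apply/funext => x; rewrite expRN lnK// posrE (lt_le_trans c0).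
exists c^-1 => x; have fx0 := lt_le_trans c0 (cf x).
rewrite ger0_norm ?invr_ge0 ?(ltW fx0)//.
by rewrite lef_pV2 ?posrE.
Qed.

Variable P : probability T R.

Lemma bm_integrable f : bounded_measurable f -> P.-integrable setT (EFin \o f).
Proof.
move=> [mf [M fM]]; apply: measurable_bounded_integrable => //.
  by rewrite (le_lt_trans (probability_le1 _ _))// ltry.
by exists M; split; [exact: num_real | move=> y My x _; exact: le_trans (fM x) (ltW My)].
Qed.

Lemma EFin_Rintegral f : bounded_measurable f ->
  (\int[P]_x (f x)%:E)%E = (\int[P]_x f x)%:E.
Proof.
by move=> bf; rewrite fineK//; apply: (integrable_fin_num _ (bm_integrable bf)).
Qed.

Lemma mean_cst c : \int[P]_x c = c.
Proof.
rewrite Rintegral_cst// -[RHS]mulr1; congr (_ * _).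
exact: (congr1 fine (probability_setT P)).
Qed.

Lemma meanD f g : bounded_measurable f -> bounded_measurable g ->
  \int[P]_x (f x + g x) = \int[P]_x f x + \int[P]_x g x.
Proof. by move=> bf bg; rewrite RintegralD//; exact: bm_integrable. Qed.

Lemma meanB f g : bounded_measurable f -> bounded_measurable g ->
  \int[P]_x (f x - g x) = \int[P]_x f x - \int[P]_x g x.
Proof. by move=> bf bg; rewrite RintegralB//; exact: bm_integrable. Qed.

Lemma meanZ c f : bounded_measurable f ->
  \int[P]_x (c * f x) = c * \int[P]_x f x.
Proof. by move=> bf; rewrite RintegralZl//; exact: bm_integrable. Qed.

Lemma mean_sum I (r : seq I) (Q : pred I) (F : I -> T -> R) :
  (forall i, Q i -> bounded_measurable (F i)) ->
  \int[P]_x (\sum_(i <- r | Q i) F i x) = \sum_(i <- r | Q i) \int[P]_x F i x.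
Proof.
move=> bF; elim: r => [|i r IH].
  by under eq_Rintegral do rewrite big_nil; rewrite mean_cst big_nil.
under eq_Rintegral do rewrite big_cons; rewrite big_cons; case: ifPn => // Qi.
by rewrite meanD ?IH//; [exact: bF | exact: bm_sum].
Qed.

Lemma mean_le f g : bounded_measurable f -> bounded_measurable g ->
  (forall x, f x <= g x) -> \int[P]_x f x <= \int[P]_x g x.
Proof. by move=> bf bg fg; apply: le_Rintegral => //; exact: bm_integrable. Qed.

End bounded_measurable.

Lemma bm_comp d d' (T : measurableType d) (T' : measurableType d') (R : realType)
    (h : T' -> T) (f : T -> R) :
  measurable_fun [set: T'] h -> bounded_measurable f ->
  bounded_measurable (fun x => f (h x)).
Proof.
by move=> mh [mf [M fM]]; split; [exact: measurableT_comp | exists M].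
Qed.

Section mean_image.
Context d d' {T : measurableType d} {T' : measurableType d'} {R : realType}.

Lemma mean_distribution (P : probability T R) (X : {mfun T >-> T'}) (f : T' -> R) :
  bounded_measurable f ->
  \int[distribution P X]_y f y = \int[P]_x f (X x).
Proof.
move=> bf; rewrite /Rintegral integral_distribution//.
  by apply/measurable_EFinP; case: bf.
by apply: (@bm_integrable _ _ _ P (fun x => f (X x))); exact: bm_comp.
Qed.

Section product.
Variables (P : probability T R) (P' : probability T' R) (f : T * T' -> R).
Hypothesis bf : bounded_measurable f.

Lemma bm_section x : bounded_measurable (fun y => f (x, y)).
Proof. by apply: (bm_comp (h := pair x)) => //; exact: measurable_pair1. Qed.

Let int_f : (P \x P')%E.-integrable setT (EFin \o f).
Proof. exact: bm_integrable. Qed.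

Let fubini_F_mean : fubini_F P' (EFin \o f) = EFin \o (fun x => \int[P']_y f (x, y)).
Proof. by apply/funext => x; rewrite /fubini_F/= -EFin_Rintegral//; exact: bm_section. Qed.

Lemma bm_mean_section : bounded_measurable (fun x => \int[P']_y f (x, y)).
Proof.
split.
  by apply/measurable_EFinP; rewrite -fubini_F_mean; exact: (measurable_fubini_F int_f).
have [_ [M fM]] := bf; exists M => x.
have bfx := bm_section x.
rewrite -[leRHS](mean_cst P').
apply: le_trans (le_normr_Rintegral _ _) _ => //; first exact: bm_integrable.
by apply: mean_le => //; [exact: bm_norm | exact: bm_cst].
Qed.

Lemma mean_prod : \int[(P \x P')%E]_z f z = \int[P]_x \int[P']_y f (x, y).
Proof.
by rewrite {1}/Rintegral -(integral12_prod_meas1 int_f) fubini_F_mean.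
Qed.

End product.
End mean_image.

Lemma mean_iidS d (T : measurableType d) (R : realType) (P : probability T R) n
    (h : n.+1.-tuple T -> R) : bounded_measurable h ->
  \int[iid_law P n.+1]_D h D =
  \int[P]_z \int[iid_law P n]_D h (tcons (z, D)).
Proof.
move=> bh; rewrite mean_distribution// mean_prod//.
by apply: bm_comp bh; exact: measurable_tcons.
Qed.

Lemma mean_iid0 d (T : measurableType d) (R : realType) (P : probability T R)
    (h : 0.-tuple T -> R) : bounded_measurable h ->
  \int[iid_law P 0]_D h D = h [tuple].
Proof.
move=> [mh _]; rewrite /Rintegral/= integral_dirac//; last exact/measurable_EFinP.
by rewrite diracT mul1e.
Qed.

(** * The logistic link *)

Section sigmoid.
Context {R : realType}.
Implicit Types u h : R.

Definition sigmoid u : R := expR u / (1 + expR u).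

Lemma sigmoid_gt0 u : 0 < sigmoid u.
Proof. by rewrite divr_gt0 ?expR_gt0// addr_gt0 ?expR_gt0. Qed.

Lemma onem_sigmoid u : 1 - sigmoid u = (1 + expR u)^-1.
Proof. by rewrite /sigmoid; have := expR_gt0 u => ?; field; lra. Qed.

Lemma sigmoid_lt1 u : sigmoid u < 1.
Proof. by rewrite -subr_gt0 onem_sigmoid invr_gt0 addr_gt0 ?expR_gt0. Qed.

Lemma ln_odds_sigmoid u : ln (sigmoid u / (1 - sigmoid u)) = u.
Proof.
by rewrite onem_sigmoid invrK /sigmoid mulfVK ?expRK// gt_eqF// addr_gt0 ?expR_gt0.
Qed.

Lemma sigmoidE u : sigmoid u = expR (u - ln (1 + expR u)).
Proof. by rewrite expRD expRN lnK// posrE addr_gt0 ?expR_gt0. Qed.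

Lemma measurable_sigmoid : measurable_fun [set: R] sigmoid.
Proof.
rewrite (_ : sigmoid = fun u => expR (u - ln (1 + expR u))).
  apply: (measurableT_comp (@measurable_expR R)); apply: measurable_funB => //.
  by apply: (measurableT_comp (@measurable_ln R)); exact: measurable_funD.
by apply/funext => u; exact: sigmoidE.
Qed.

(** The difference between the probabilities of the two labels, [tanh (u / 2)]. *)
Definition signal u : R := 2 * sigmoid u - 1.

Lemma signalE u : signal u = (expR u - 1) / (expR u + 1).
Proof. by rewrite /signal /sigmoid; have := expR_gt0 u => ?; field; lra. Qed.

Lemma signalN u : signal (- u) = - signal u.
Proof. by rewrite !signalE expRN; have := expR_gt0 u => ?; field; lra. Qed.

Lemma signal_ge0 u : (0 <= signal u) = (0 <= u).
Proof.
rewrite signalE pmulr_lge0 ?invr_gt0 ?addr_gt0 ?expR_gt0//.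
by rewrite subr_ge0 -expR0 ler_expR.
Qed.

Lemma normr_signal_le1 u : `|signal u| <= 1.
Proof.
have := sigmoid_gt0 u; have := sigmoid_lt1 u => ? ?.
by rewrite /signal ler_norml; lra.
Qed.

Lemma signal_linear u : `|signal u - u / 2| <= u ^+ 2.
Proof.
wlog u0 : u / 0 <= u.
  move=> H; have [/H//|u0] := leP 0 u.
  have := H (- u); rewrite signalN sqrrN mulNr -opprD normrN; apply; lra.
have E1 : 1 + u <= expR u by exact: expR_ge1Dx.
have [u1|u1] := leP 1 u.
  have := normr_signal_le1 u; have : 0 <= signal u by rewrite signal_ge0.
  by rewrite !ler_norml; nra.
have E2 : expR u * (1 - u) <= 1.
  have := expR_ge1Dx (- u); rewrite expRN => h.
  by rewrite mulrC -ler_pdivlMr ?expR_gt0// div1r.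
have e0 := expR_gt0 u.
rewrite signalE ler_norml lerBrDr lerBlDr ler_pdivlMr ?ler_pdivrMr; [|lra|lra].
by apply/andP; split; nra.
Qed.

(** The chi-square distance between the Bernoulli laws of logits [u] and
    [u + h] is [p (1 - p) (e^h - 1)^2 / (1 - p + p e^h)^2], and the
    denominator is at least [4 p (1 - p) e^h]: hence a bound free of [u]. *)
Lemma sigmoid_chi2 u h : `|h| <= 1 ->
  (sigmoid (u + h) - sigmoid u) ^+ 2 <=
  h ^+ 2 * (sigmoid u * (1 - sigmoid u)).
Proof.
move=> h1; rewrite onem_sigmoid /sigmoid expRD.
have sinh2 : (expR h - 1) ^+ 2 <= 4 * h ^+ 2 * expR h.
  wlog h0 : h h1 / 0 <= h.
    move=> H; have [/H->//|h0] := leP 0 h.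
    have := H (- h); rewrite normrN sqrrN expRN => /(_ h1); rewrite oppr_ge0.
    move=> /(_ (ltW h0)); have e0 := expR_gt0 h => H'.
    rewrite (_ : (expR h - 1) ^+ 2 = ((expR h)^-1 - 1) ^+ 2 * expR h ^+ 2).
      rewrite (_ : 4 * h ^+ 2 * expR h = 4 * h ^+ 2 / expR h * expR h ^+ 2).
        by rewrite ler_wpM2r// sqr_ge0.
      by field; lra.
    by field; lra.
  have -> : expR h = expR (h / 2) ^+ 2 by rewrite -expRM_natl; congr expR; field.
  move: h1; rewrite ger0_norm// => h1.
  have e1 : 1 + h / 2 <= expR (h / 2) by exact: expR_ge1Dx.
  have e2 : expR (h / 2) * (1 - h / 2) <= 1.
    have := expR_ge1Dx (- (h / 2)); rewrite expRN => H.
    by rewrite mulrC -ler_pdivlMr ?expR_gt0// div1r.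
  set c := expR (h / 2) in e1 e2 *.
  have : 0 <= c ^+ 2 - 1 <= 2 * h * c.
    apply/andP; split; first by rewrite subr_ge0; nra.
    have : c ^+ 2 - 1 <= c * (c - (1 - h / 2)) by nra.
    have : c - (1 - h / 2) <= 2 * h by nra.
    nra.
  move=> /andP[p0 p1].
  rewrite -[leRHS](_ : (2 * h * c) ^+ 2 = _); last by ring.
  by rewrite ler_sqr// nnegrE (le_trans p0).
set a := expR u; set b := expR h in sinh2 *.
have a0 : 0 < a := expR_gt0 u; have b0 : 0 < b := expR_gt0 h.
have -> : a * b / (1 + a * b) - a / (1 + a) =
    a * (b - 1) / ((1 + a * b) * (1 + a)).
  by field; rewrite !gt_eqF// ?addr_gt0 ?mulr_gt0.
have ab0 : 0 < a * b by rewrite mulr_gt0.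
rewrite expr_div_n ler_pdivrMr; last by rewrite exprn_gt0// mulr_gt0; lra.
have -> : h ^+ 2 * (a / (1 + a) / (1 + a)) * ((1 + a * b) * (1 + a)) ^+ 2 =
   h ^+ 2 * a * (1 + a * b) ^+ 2 by field; lra.
rewrite exprMn.
have : a ^+ 2 * (b - 1) ^+ 2 <= a ^+ 2 * (4 * h ^+ 2 * b).
  by rewrite ler_wpM2l// sqr_ge0.
move=> /le_trans; apply.
have : 0 <= h ^+ 2 * a * (1 - a * b) ^+ 2.
  by rewrite mulr_ge0 ?sqr_ge0// mulr_ge0 ?sqr_ge0 ?ltW.
by move=> ?; rewrite -subr_ge0 (_ : _ - _ = h ^+ 2 * a * (1 - a * b) ^+ 2)//; ring.
Qed.

End sigmoid.

(** * The law of the labelled sample *)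

Lemma bm_indic d (T : measurableType d) (R : realType) (A : set T) :
  measurable A -> bounded_measurable (\1_A : T -> R).
Proof.
move=> mA; split; first exact: measurable_indic.
by exists 1 => x; rewrite indicE; case: (_ \in _); rewrite ?normr1 ?normr0.
Qed.

Lemma probability_mean d (T : measurableType d) (R : realType)
    (P : probability T R) (A : set T) : measurable A ->
  P A = (\int[P]_x \1_A x)%:E.
Proof.
by move=> mA; rewrite -EFin_Rintegral ?integral_indic ?setIT//; exact: bm_indic.
Qed.

Lemma bounded_integrable01 (R : realType) (f : R -> R) :
  bounded_measurable f ->
  lebesgue_measure.-integrable `[0%R, 1%R] (EFin \o f).
Proof.
move=> [mf [M fM]]; apply: measurable_bounded_integrable => //=.
- by rewrite lebesgue_measure_itv/= lte_fin ltr01 -EFinB ltry.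
- exact: measurable_funTS.
- by exists M; split; [exact: num_real | move=> y My x _; exact: le_trans (fM x) (ltW My)].
Qed.

Section uniform.
Context {R : realType}.
Notation mu := (@lebesgue_measure R).

Definition borel_id : measurableTypeR R -> R := idfun.

HB.instance Definition _ :=
  @isMeasurableFun.Build _ _ _ _ borel_id (@measurable_id _ _ setT).

(** [uniform_prob] is a law on [measurableTypeR R], whose measurable sets are those
    of [R] under another presentation; the identity transports it to [R]. *)
Definition uniform01 : probability R R :=
  distribution (uniform_prob (@ltr01 R))
    (borel_id : {mfun measurableTypeR R >-> R}).

Lemma Rintegral01_cst (c : R) : \int[mu]_(t in `[0%R, 1%R]) c = c.
Proof.
have mu1 : mu `[0%R, 1%R] = 1%E.
  by rewrite lebesgue_measure_itv/= lte_fin ltr01 -EFinB subr0.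
by rewrite Rintegral_cst// -[RHS]mulr1; congr (_ * _); exact: (congr1 fine mu1).
Qed.

(** Means against [uniform_prob] are known for nonnegative functions only, whence
    the shift by the bound [M] of [f]. *)
Lemma mean_uniform (f : R -> R) : bounded_measurable f ->
  \int[uniform01]_x f x = \int[mu]_(x in `[0%R, 1%R]) f x.
Proof.
move=> bf; have [mf [M fM]] := bf; rewrite mean_distribution//.
set U := uniform_prob _.
have bM := bm_cst (T := R) (R := R) M.
have bfM := bmD bf bM.
have E : \int[U]_x (f x + M) = \int[mu]_(x in `[0%R, 1%R]) (f x + M).
  rewrite /Rintegral integral_uniform.
  - by rewrite subr0 invr1 mul1e.
  - by apply/measurable_EFinP; case: bfM.
  - by move=> x; rewrite lee_fin -lerBlDr sub0r; have := fM x; rewrite ler_norml => /andP[].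
rewrite -[LHS](addrK M) -[X in _ + X - _](mean_cst U) -meanD// E.
rewrite RintegralD//=; [|exact: bounded_integrable01..].
by rewrite Rintegral01_cst addrK.
Qed.

Lemma mean_uniform_le (p : R) : 0 <= p <= 1 -> \int[uniform01]_v ((v : R) <= p)%R%:R = p.
Proof.
move=> /andP[p0 p1].
have E : (fun v => ((v : R) <= p)%R%:R) = \1_`]-oo, p] :> (R -> R).
  by apply/funext => v; rewrite indicE mem_setE in_itv.
rewrite E mean_uniform; last exact: bm_indic.
have mup : mu `[0, p] = p%:E.
  by rewrite lebesgue_measure_itv/= lte_fin; case: ltgtP p0 => // [_|<-]; rewrite -?EFinB ?subr0.
rewrite /Rintegral integral_indic// (_ : _ `&` _ = `[0, p]%classic).
  exact: (congr1 fine mup).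
apply/seteqP; split => x /=; rewrite !in_itv/=; first by move=> [-> /andP[->]].
by move=> /andP[-> xp]; rewrite xp (le_trans xp).
Qed.
End uniform.

Section logistic_model.
Context {d} {X : measurableType d} {R : realType} (PX : probability X R).

Definition label (g : X -> R) (z : X * R) : X * bool :=
  (z.1, z.2 <= sigmoid (g z.1)).

Section measurable_label.
Variable g : {mfun X >-> R}.

Lemma measurable_label : measurable_fun [set: X * R] (label g).
Proof.
apply: measurable_fun_pair; first exact: measurable_fst.
apply: measurable_fun_ler; first exact: measurable_snd.
apply: (measurableT_comp measurable_sigmoid).
by apply: measurableT_comp => //; exact: measurable_fst.
Qed.

HB.instance Definition _ :=
  isMeasurableFun.Build _ _ _ _ (label g) measurable_label.
End measurable_label.

(** Drawing the label by comparing an independent uniform variable with the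
    conditional probability presents the joint law as an image of a product
    law, to which Fubini's theorem applies. *)
Definition labelled_law (g : {mfun X >-> R}) : probability (X * bool)%type R :=
  distribution (PX \x uniform01)%E
    (label g : {mfun (X * R)%type >-> (X * bool)%type}).

Variable g : {mfun X >-> R}.

Lemma bm_sigmoid : bounded_measurable (fun x => sigmoid (g x)).
Proof.
split; first by apply: measurableT_comp => //; exact: measurable_sigmoid.
by exists 1 => x; rewrite ger0_norm ltW ?sigmoid_lt1 ?sigmoid_gt0.
Qed.

Lemma bm_signal : bounded_measurable (fun x => signal (g x)).
Proof. by apply: bmB (bm_cst 1); exact/bmZ/bm_sigmoid. Qed.

Lemma mean_labelled (h : X * bool -> R) : bounded_measurable h ->
  \int[labelled_law g]_z h z =
  \int[PX]_x (sigmoid (g x) * h (x, true) + (1 - sigmoid (g x)) * h (x, false)).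
Proof.
move=> bh; rewrite mean_distribution// mean_prod; last first.
  by apply: bm_comp bh; exact: measurable_label.
apply: eq_Rintegral => x _.
transitivity (\int[uniform01]_v (h (x, false) +
    (h (x, true) - h (x, false)) * ((v : R) <= sigmoid (g x))%R%:R)).
  apply: eq_Rintegral => v _; transitivity (h (x, (v : R) <= sigmoid (g x))) => //.
  by case: (_ <= _); rewrite ?mulr1 ?mulr0 ?addr0// addrC subrK.
have bi : bounded_measurable (fun v : R => ((v : R) <= sigmoid (g x))%R%:R : R).
  split; last by exists 1 => v; case: (_ <= sigmoid _); rewrite /= ?normr1 ?normr0.
  rewrite (_ : (fun v => _) = \1_`]-oo, sigmoid (g x)]); first exact: measurable_indic.
  by apply/funext => v; rewrite indicE mem_setE in_itv.
rewrite meanD; [|exact: bm_cst|exact: bmZ].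
rewrite mean_cst meanZ// mean_uniform_le; first by ring.
by rewrite !ltW ?sigmoid_gt0 ?sigmoid_lt1.
Qed.

Lemma labelled_law_rectangle (A : set X) (C : set bool) : measurable A ->
  labelled_law g (A `*` C) =
  (\int[PX]_(x in A) bernoulli_prob (sigmoid (g x)) C)%E.
Proof.
move=> mA; rewrite probability_mean; last exact: measurableX.
rewrite mean_labelled; last by apply: bm_indic; exact: measurableX.
rewrite -EFin_Rintegral; last first.
  apply: bmD; apply: bmM.
  - exact: bm_sigmoid.
  - apply: (bm_comp (h := fun x => (x, true))) => //.
  by apply: bm_indic; exact: measurableX.
  - exact: bmB (bm_cst 1) bm_sigmoid.
  - apply: (bm_comp (h := fun x => (x, false))) => //.
  by apply: bm_indic; exact: measurableX.
rewrite [RHS]integral_mkcond; apply: eq_integral => x _.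
rewrite patchE bernoulli_probE ?ltW ?sigmoid_gt0 ?sigmoid_lt1//.
rewrite !indicE !diracE !in_setX/=.
by case: (x \in A); rewrite /= ?mulr0 ?addr0// -!EFinM -EFinD.
Qed.

End logistic_model.

(** * Excess risk and likelihoods *)

(** Votes in [{-1, 1}] make the loss affine in the vote. *)
Definition vote {R : realType} (b : bool) : R := if b then 1 else -1.

Lemma bm_vote d (T : measurableType d) (R : realType) (e : T -> bool) :
  measurable_fun [set: T] e -> bounded_measurable (fun x => vote (e x) : R).
Proof.
move=> me; split; last by exists 1 => x; rewrite /vote; case: ifP; rewrite ?normrN1 ?normr1.
by apply: measurable_fun_if.
Qed.

Section excess_risk.
Context {R : realType} {d n : nat} (PX : probability (d.-tuple R) R).
Variable g : {mfun (d.-tuple R) >-> R}.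
Let X := d.-tuple R.
Let Q := labelled_law PX g.

(** Given [x], a vote [v] errs with probability [(1 - v tau) / 2]. *)
Lemma risk_labelled (e : X -> bool) : measurable_fun [set: X] e ->
  risk Q e = (\int[PX]_x ((1 - vote (e x) * signal (g x)) / 2))%:E.
Proof.
move=> me; have mE : measurable [set z : X * bool | z.2 != e z.1].
  have me1 : measurable_fun [set: X * bool] (e \o fst) by exact: measurableT_comp.
  rewrite (_ : mkset _ = ([set: X * bool] `&` (e \o fst) @^-1` [set true]
      `&` ([set: X * bool] `&` snd @^-1` [set false])) `|`
    ([set: X * bool] `&` (e \o fst) @^-1` [set false]
      `&` ([set: X * bool] `&` snd @^-1` [set true]))).
    by apply: measurableU; apply: measurableI; [exact: me1|exact: measurable_snd|
      exact: me1|exact: measurable_snd].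
  apply/seteqP; split => -[x y] /=; last by move=> [[[_ ->] [_ ->]]|[[_ ->] [_ ->]]].
  by case: y; case: (e x) => // _; [right|left].
rewrite /risk probability_mean// mean_labelled; last exact: bm_indic.
congr EFin; apply: eq_Rintegral => x _.
have iE y : \1_[set z : X * bool | z.2 != e z.1] (x, y) = (y != e x)%:R :> R.
  by rewrite indicE; congr (nat_of_bool _)%:R; apply/idP/idP; rewrite inE.
by rewrite !iE /signal /vote; case: (e x) => /=; field.
Qed.

Variable eta : data_classifier R d n.

Let bm_eta : bounded_measurable (fun z => vote (eta z) : R).
Proof. exact: bm_vote. Qed.

(** The Bayes classifier votes with the sign of the signal, so its own loss is
    [(1 - |tau|) / 2]. *)
Lemma excess_riskE : excess_risk Q g eta =
  (\int[iid_law Q n]_D \int[PX]_x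
     ((`|signal (g x)| - vote (eta (D, x)) * signal (g x)) / 2))%:E.
Proof.
have bs := bm_signal g.
have mb : measurable_fun [set: X] (bayes g).
  by apply: measurable_fun_ler.
have meta D : measurable_fun [set: X] (fun x => eta (D, x)).
  by apply: measurableT_comp => //; exact: measurable_pair1.
have bv D := bm_vote R (meta D).
have half (h : X -> R) : bounded_measurable h -> bounded_measurable (fun x => h x / 2).
  by move=> bh; exact: bmM bh (bm_cst 2^-1).
have b1 D : bounded_measurable (fun x => (1 - vote (eta (D, x)) * signal (g x)) / 2).
  by apply: half; apply: bmB (bm_cst 1) _; exact: bmM.
have b1' : bounded_measurable
    (fun z : n.-tuple (X * bool) * X => (1 - vote (eta z) * signal (g z.2)) / 2).
  apply: bmM (bm_cst 2^-1); apply: bmB (bm_cst 1) _; apply: bmM => //.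
  by apply: (bm_comp _ bs).
have b2 : bounded_measurable (fun x => (1 - vote (bayes g x) * signal (g x)) / 2).
  by apply: half; apply: bmB (bm_cst 1) _; apply: bmM => //; exact: bm_vote.
rewrite /excess_risk risk_labelled//.
under eq_integral do rewrite risk_labelled//.
rewrite EFin_Rintegral; last exact: (bm_mean_section (iid_law Q n) PX b1').
rewrite -EFinB; congr EFin.
rewrite -[X in _ - X](mean_cst (iid_law Q n)) -meanB; last 2 first.
- exact: (bm_mean_section (iid_law Q n) PX b1').
- exact: bm_cst.
apply: eq_Rintegral => D _; rewrite -meanB//; apply: eq_Rintegral => x _.
rewrite /bayes; have := signal_ge0 (g x).
case: (leP 0 (g x)) => _ s0.
  by rewrite ger0_norm// /vote; case: (eta _); field.
rewrite ltr0_norm; last by rewrite ltNge s0.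
by rewrite /vote; case: (eta _); field.
Qed.

End excess_risk.

Section iid_products.
Context d (T : measurableType d) (R : realType).
Implicit Types (P : probability T R) (f : T -> R).

Lemma bm_tuple_prod n f : bounded_measurable f ->
  bounded_measurable (fun D : n.-tuple T => \prod_(i < n) f (tnth D i)).
Proof.
move=> bf; apply: bm_prod => i _.
by apply: (bm_comp (h := fun D => tnth D i)) bf; exact: measurable_tnth.
Qed.

Lemma tuple_prod_tcons n f z (D : n.-tuple T) :
  \prod_(i < n.+1) f (tnth (tcons (z, D)) i) = f z * \prod_(i < n) f (tnth D i).
Proof.
rewrite big_ord_recl; congr (_ * _).
by apply: eq_bigr => i _; rewrite tnthS.
Qed.

Lemma mean_iid_prod P n f : bounded_measurable f ->
  \int[iid_law P n]_D (\prod_(i < n) f (tnth D i)) = (\int[P]_z f z) ^+ n.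
Proof.
move=> bf; elim: n => [|n IH].
  by rewrite mean_iid0 ?big_ord0 ?expr0//; exact: bm_tuple_prod.
rewrite (mean_iidS _ (bm_tuple_prod _ bf)) exprSr -meanZ//.
apply: eq_Rintegral => z _; rewrite -IH mulrC -meanZ; last exact: bm_tuple_prod.
by apply: eq_Rintegral => D _; rewrite tuple_prod_tcons.
Qed.

Lemma mean_iid_density P P0 f : bounded_measurable f ->
  (forall h, bounded_measurable h ->
    \int[P]_z h z = \int[P0]_z (f z * h z)) ->
  forall n (h : n.-tuple T -> R), bounded_measurable h ->
  \int[iid_law P n]_D h D =
  \int[iid_law P0 n]_D (\prod_(i < n) f (tnth D i) * h D).
Proof.
move=> bf Pf; elim=> [|n IH] h bh.
  rewrite !mean_iid0//; first by rewrite big_ord0 mul1r.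
  by apply: bmM => //; exact: bm_tuple_prod.
have bt := bm_comp (@measurable_tcons _ T n) bh.
rewrite (mean_iidS P bh) (mean_iidS P0 (bmM (bm_tuple_prod _ bf) bh)).
rewrite Pf; last exact: (bm_mean_section P _ bt).
apply: eq_Rintegral => z _; rewrite IH; last exact: (bm_section bt).
rewrite -meanZ; last first.
  by apply: bmM; [exact: bm_tuple_prod | exact: (bm_section bt)].
by apply: eq_Rintegral => D _; rewrite tuple_prod_tcons mulrA.
Qed.

End iid_products.

Section likelihood.
Context {dX} {X : measurableType dX} {R : realType} (PX : probability X R).
Implicit Types (g : {mfun X >-> R}) (n : nat).

(** Dominating law of the likelihoods: the label is a fair coin, independent of
    the features. *)
Definition coin_law : probability (X * bool)%type R := labelled_law PX (cst 0).

Definition density (g : X -> R) (z : X * bool) : R :=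
  2 * (if z.2 then sigmoid (g z.1) else 1 - sigmoid (g z.1)).

Definition likelihood (g : X -> R) n (D : n.-tuple (X * bool)) : R :=
  \prod_(i < n) density g (tnth D i).

Lemma density_gt0 (g : X -> R) z : 0 < density g z.
Proof.
by rewrite mulr_gt0//; case: ifP; rewrite ?subr_gt0 ?sigmoid_gt0 ?sigmoid_lt1.
Qed.

Lemma likelihood_gt0 (g : X -> R) n D : 0 < @likelihood g n D.
Proof. by apply: prodr_gt0 => i _; exact: density_gt0. Qed.

Lemma bm_density g : bounded_measurable (density g).
Proof.
apply/bmZ; have bs := bm_comp (@measurable_fst _ _ X bool) (bm_sigmoid g).
have -> : (fun z : X * bool => if z.2 then sigmoid (g z.1) else 1 - sigmoid (g z.1)) =
   (fun z => sigmoid (g z.1) * \1_[set true] z.2 +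
             (1 - sigmoid (g z.1)) * \1_[set false] z.2).
  have E (b c : bool) : \1_[set b] c = (c == b)%:R :> R.
    by rewrite indicE; congr (nat_of_bool _)%:R; apply/idP/eqP; rewrite inE.
  by apply/funext => -[x []]/=; rewrite !E/= ?mulr1 ?mulr0 ?addr0 ?add0r.
apply: bmD; apply: bmM.
- exact: bs.
- by apply: (bm_comp (h := snd)) => //; exact: bm_indic.
- exact: bmB (bm_cst 1) bs.
- by apply: (bm_comp (h := snd)) => //; exact: bm_indic.
Qed.

Lemma mean_density g h : bounded_measurable h ->
  \int[labelled_law PX g]_z h z = \int[coin_law]_z (density g z * h z).
Proof.
move=> bh; rewrite !mean_labelled//; last by apply: bmM => //; exact: bm_density.
apply: eq_Rintegral => x _; rewrite /density/=.
have -> : sigmoid 0 = 2^-1 :> R by rewrite /sigmoid expR0; field.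
by field.
Qed.

Lemma bm_likelihood g n : bounded_measurable (@likelihood g n).
Proof.
apply: bm_prod => i _; apply: (bm_comp (h := fun D => tnth D i)).
  exact: measurable_tnth.
exact: bm_density.
Qed.

Lemma mean_likelihood g n (h : n.-tuple (X * bool) -> R) :
  bounded_measurable h ->
  \int[iid_law (labelled_law PX g) n]_D h D =
  \int[iid_law coin_law n]_D (likelihood g D * h D).
Proof. by apply: mean_iid_density; [exact: bm_density | exact: mean_density]. Qed.

End likelihood.

(** * Averages over a finite product *)

Section finite_product.
Context {R : realFieldType} {I T : finType}.
Implicit Types (th : {ffun I -> T}) (i : I) (t : T).

Definition update th i t : {ffun I -> T} :=
  [ffun j => if j == i then t else th j].

Lemma update_same th i t : update th i t i = t.
Proof. by rewrite ffunE eqxx. Qed.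

Lemma update_other th i j t : j != i -> update th i t j = th j.
Proof. by rewrite ffunE => /negbTE ->. Qed.

Lemma update_id th i : update th i (th i) = th.
Proof. by apply/ffunP => j; rewrite ffunE; case: eqP => // ->. Qed.

Lemma update_update th i t t' : update (update th i t) i t' = update th i t'.
Proof. by apply/ffunP => j; rewrite !ffunE; case: eqP. Qed.

(** Exchanging the value at [i] with a fresh one preserves the uniform law on
    pairs of a configuration and a value. *)
Lemma sum_update i (F : {ffun I -> T} -> R) :
  \sum_th \sum_t F (update th i t) = #|T|%:R * \sum_th F th.
Proof.
rewrite pair_big/= (reindex_inj (h := fun z => (update z.1 i z.2, z.1 i)))/=.
  under eq_bigr do rewrite update_update update_id.
  rewrite -(pair_big xpredT xpredT (fun th (_ : T) => F th))/= mulr_sumr.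
  by apply: eq_bigr => th _; rewrite sumr_const mulr_natl.
apply: (can_inj (g := fun z => (update z.1 i z.2, z.1 i))) => -[th t]/=.
by rewrite update_update update_id update_same.
Qed.

Variable flip : T -> T.
Hypothesis flipK : involutive flip.

Let flip_at i th := update th i (flip (th i)).

Let flip_atK i : involutive (flip_at i).
Proof. by move=> th; rewrite /flip_at update_update update_same flipK update_id. Qed.

(** Flipping coordinate [i] preserves the uniform law and changes the sign. *)
Lemma sum_odd i (F : {ffun I -> T} -> R) :
  (forall th, F (flip_at i th) = - F th) -> \sum_th F th = 0.
Proof.
move=> Fodd; have : \sum_th F th = - \sum_th F th; last by lra.
rewrite -sumrN [LHS](reindex_inj (inv_inj (flip_atK i)))/=.
by apply: eq_bigr => th _.
Qed.

(** Under the uniform law the [Z i (th i)] are independent and symmetric: odd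
    moments vanish, and the sums have the moments of a Rademacher sum with
    coefficients bounded by [b]. *)
Variables (Z : I -> T -> R) (b : I -> R).
Hypothesis Zflip : forall i t, Z i (flip t) = - Z i t.
Hypothesis Zb : forall i t, `|Z i t| <= b i.

Let S (r : seq I) th := \sum_(j <- r) Z j (th j).
Let V (r : seq I) := \sum_(j <- r) b j ^+ 2.
Let N : R := #|{ffun I -> T}|%:R.

Let S_flip r i th : i \notin r -> S r (flip_at i th) = S r th.
Proof.
move=> ir; apply: eq_big_seq => j jr; congr Z.
by apply: update_other; apply: contraNneq ir => <-.
Qed.

Let Z_flip i th : Z i (flip_at i th i) = - Z i (th i).
Proof. by rewrite update_same. Qed.

Let Z2 i t : Z i t ^+ 2 <= b i ^+ 2.
Proof. by rewrite -real_normK ?num_real// ler_sqr ?nnegrE ?(le_trans _ (Zb i t)). Qed.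

Lemma second_moment r : uniq r -> \sum_th S r th ^+ 2 <= V r * N.
Proof.
elim: r => [|i r IH] /=.
  by rewrite /V big_nil mul0r; under eq_bigr do rewrite /S big_nil expr0n/=; rewrite big1.
move=> /andP[ir /IH{}IH].
have -> : \sum_th S (i :: r) th ^+ 2 =
    \sum_th S r th ^+ 2 + 2 * \sum_(th : {ffun I -> T}) (S r th * Z i (th i)) + \sum_(th : {ffun I -> T}) Z i (th i) ^+ 2.
  rewrite mulr_sumr -!big_split/=; apply: eq_bigr => th _.
  by rewrite /S big_cons; ring.
rewrite (sum_odd (i := i) (F := fun th => S r th * Z i (th i))); last first.
  by move=> th; rewrite S_flip// Z_flip mulrN.
rewrite mulr0 addr0 /V big_cons -/(V r) mulrDl addrC lerD//.
rewrite (le_trans (ler_sum _ (fun th _ => Z2 i (th i))))//.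
by rewrite sumr_const mulr_natr.
Qed.

(** In the expansion of the fourth power of [S + Z_i] the terms odd in [Z_i]
    cancel; the constant 3 propagates since
    [3 V^2 + 6 b^2 V + b^4 <= 3 (V + b^2)^2]. *)
Lemma fourth_moment r : uniq r -> \sum_th S r th ^+ 4 <= 3 * V r ^+ 2 * N.
Proof.
elim: r => [|i r IH] /=.
  rewrite /V big_nil expr0n mulr0 mul0r.
  by under eq_bigr do rewrite /S big_nil expr0n/=; rewrite big1.
move=> /andP[ir ur]; have {}IH := IH ur; have S2 := second_moment ur.
have -> : \sum_th S (i :: r) th ^+ 4 =
    \sum_th S r th ^+ 4 + 4 * \sum_(th : {ffun I -> T}) (S r th ^+ 3 * Z i (th i)) +
    6 * \sum_(th : {ffun I -> T}) (S r th ^+ 2 * Z i (th i) ^+ 2) +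
    4 * \sum_(th : {ffun I -> T}) (S r th * Z i (th i) ^+ 3) + \sum_(th : {ffun I -> T}) Z i (th i) ^+ 4.
  rewrite !mulr_sumr -!big_split/=; apply: eq_bigr => th _.
  by rewrite /S big_cons; ring.
rewrite (sum_odd (i := i) (F := fun th => S r th ^+ 3 * Z i (th i))); last first.
  by move=> th; rewrite S_flip// Z_flip mulrN.
rewrite (sum_odd (i := i) (F := fun th => S r th * Z i (th i) ^+ 3)); last first.
  by move=> th; rewrite S_flip// Z_flip; ring.
rewrite !mulr0 !addr0.
have S2Z : \sum_(th : {ffun I -> T}) (S r th ^+ 2 * Z i (th i) ^+ 2) <= b i ^+ 2 * (V r * N).
  apply: (@le_trans _ _ (b i ^+ 2 * \sum_th S r th ^+ 2)).
    by rewrite mulr_sumr ler_sum// => th _; rewrite mulrC ler_wpM2r ?sqr_ge0.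
  by rewrite ler_wpM2l ?sqr_ge0.
have Z4 : \sum_(th : {ffun I -> T}) Z i (th i) ^+ 4 <= b i ^+ 4 * N.
  rewrite /N mulr_natr -sumr_const ler_sum// => th _.
  by rewrite (exprM _ 2 2) (exprM (b i) 2 2) ler_sqr ?nnegrE ?sqr_ge0.
have N0 : 0 <= N by exact: ler0n.
rewrite /V big_cons -/(V r).
have : 0 <= b i ^+ 4 * N by rewrite mulr_ge0// (exprM _ 2 2) sqr_ge0.
have -> : 3 * (b i ^+ 2 + V r) ^+ 2 * N =
  3 * V r ^+ 2 * N + 6 * (b i ^+ 2 * (V r * N)) + 3 * (b i ^+ 4 * N) by ring.
lra.
Qed.

End finite_product.

(** The variance of [a / g] under the weights [g] is nonnegative. *)
Lemma sum_sqr_div_le {R : realFieldType} (J : finType) (a g : J -> R) :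
  (forall j, 0 < g j) ->
  (\sum_j a j) ^+ 2 <= (\sum_j a j ^+ 2 / g j) * \sum_j g j.
Proof.
move=> g0; set A := \sum_j a j; set G := \sum_j g j.
have : 0 <= G by apply: sumr_ge0 => j _; exact: ltW.
rewrite le_eqVlt => /predU1P[G0|G0].
  suff -> : A = 0 by rewrite expr0n -G0 mulr0.
  apply: big1 => j _; have := g0 j; have : g j <= G; last by rewrite -G0; lra.
  by rewrite /G (bigD1 j)//= lerDl sumr_ge0// => k _; exact: ltW.
rewrite -ler_pdivrMr//; set c := A / G.
have : 0 <= \sum_j (a j - c * g j) ^+ 2 / g j.
  by apply: sumr_ge0 => j _; rewrite divr_ge0 ?sqr_ge0 ?ltW.
rewrite (_ : \sum_j (a j - c * g j) ^+ 2 / g j =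
   \sum_j a j ^+ 2 / g j - A ^+ 2 / G) ?subr_ge0//.
rewrite (_ : A ^+ 2 / G = 2 * c * A - c ^+ 2 * G); last first.
  by rewrite /c; field; rewrite gt_eqF.
rewrite /A /G !mulr_sumr -!sumrB; apply: eq_bigr => j _.
by have := g0 j => ?; field; rewrite !gt_eqF.
Qed.

(** * Likelihood ratios *)

Lemma mean_prod_mul d d' (T : measurableType d) (T' : measurableType d')
    (R : realType) (P : probability T R) (P' : probability T' R)
    (f : T -> R) (g : T' -> R) :
  bounded_measurable f -> bounded_measurable g ->
  \int[(P \x P')%E]_z (f z.1 * g z.2) = \int[P]_x f x * \int[P']_y g y.
Proof.
move=> bf bg; rewrite mean_prod; last first.
  by apply: bmM; [exact: bm_comp measurable_fst bf | exact: bm_comp measurable_snd bg].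
rewrite mulrC -meanZ//; apply: eq_Rintegral => x _.
by rewrite /= meanZ// mulrC.
Qed.

Section likelihood_ratio.
Context {dX} {X : measurableType dX} {R : realType} (PX : probability X R).
Variable n : nat.

(** A bounded logit keeps both probabilities away from zero. *)
Lemma bm_density_inv (g : {mfun X >-> R}) :
  bounded_measurable g -> bounded_measurable (fun z => (density g z)^-1).
Proof.
move=> [_ [M gM]]; have [md _] := bm_density g.
apply: (@bmV _ _ _ _ (2 * (1 + expR M)^-1)) => // z.
rewrite ler_wpM2l//.
have := gM z.1; rewrite ler_norml => /andP[gM1 gM2].
have e0 := expR_gt0 M; have e1 := expR_gt0 (g z.1).
case: ifP => _; last first.
  by rewrite onem_sigmoid lef_pV2 ?posrE ?addr_gt0// lerD2l ler_expR.
rewrite /sigmoid ler_pdivlMr ?addr_gt0// mulrC ler_pdivrMr ?addr_gt0//.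
have : expR (- M) <= expR (g z.1) by rewrite ler_expR.
rewrite expRN => e2; rewrite mulrDr mulr1 addrC lerD2l.
by rewrite -ler_pdivrMr// div1r.
Qed.

Lemma bm_likelihood_inv (g : {mfun X >-> R}) :
  bounded_measurable g -> bounded_measurable (fun D => (@likelihood _ _ _ g n D)^-1).
Proof.
move=> /bm_density_inv /(bm_tuple_prod n); apply: eq_bm => D.
by rewrite /likelihood prodfV.
Qed.

Lemma mean_likelihood1 (g : {mfun X >-> R}) :
  \int[iid_law (coin_law PX) n]_D likelihood g D = 1.
Proof.
rewrite -[RHS](mean_cst (iid_law (labelled_law PX g) n)) mean_likelihood.
  by apply: eq_Rintegral => D _; rewrite mulr1.
exact: bm_cst.
Qed.

Variables (g g' : {mfun X >-> R}) (e : R).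
Hypothesis bg : bounded_measurable g.
Hypothesis small : forall x, `|g' x - g x| <= 1.
Hypothesis close : \int[PX]_x ((g' x - g x) ^+ 2) <= e.

Let bdiff : bounded_measurable (fun x => g' x - g x).
Proof. by split; [exact: measurable_funB | exists 1]. Qed.

Let bm_ratio : bounded_measurable (fun z => density g' z ^+ 2 / density g z).
Proof. by apply: bmM; [exact/bmX/bm_density | exact: bm_density_inv]. Qed.

(** The mean of [f'^2 / f] against the coin is one plus the mean over the features
    of the chi-square distance of the labels ([sigmoid_chi2]). *)
Lemma mean_density_ratio :
  0 <= \int[coin_law PX]_z (density g' z ^+ 2 / density g z) <= 1 + e.
Proof.
rewrite mean_labelled//; apply/andP; split.
  apply: Rintegral_ge0 => x _.
  by rewrite addr_ge0// mulr_ge0 ?subr_ge0 ?(ltW (sigmoid_gt0 _)) ?(ltW (sigmoid_lt1 _))//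
    divr_ge0 ?sqr_ge0// ltW// density_gt0.
apply: (@le_trans _ _ (1 + \int[PX]_x ((g' x - g x) ^+ 2))); last by rewrite lerD2l.
rewrite -[X in X + _](mean_cst PX) -meanD; [|exact: bm_cst|exact: bmX].
apply: mean_le => [| |x].
- apply: bmD; (apply: bmM; [|apply: (bm_comp _ bm_ratio) => //]).
    exact: bm_sigmoid.
  exact: bmB (bm_cst 1) (bm_sigmoid _).
- by apply: bmD (bm_cst 1) _; exact: bmX.
have -> : sigmoid 0 = 2^-1 :> R by rewrite /sigmoid expR0; field.
have := sigmoid_chi2 (g x) (small x); rewrite (addrC (g x)) subrK /density/=.
have := sigmoid_gt0 (g x); have := sigmoid_lt1 (g x).
set p := sigmoid (g x); set q := sigmoid (g' x); set h := _ ^+ 2 => p1 p0 pq.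
have p1p : 0 < p * (1 - p) by rewrite mulr_gt0 ?subr_gt0.
have -> : 2^-1 * ((2 * q) ^+ 2 / (2 * p)) +
    (1 - 2^-1) * ((2 * (1 - q)) ^+ 2 / (2 * (1 - p))) =
    1 + (q - p) ^+ 2 / (p * (1 - p)) by field; rewrite !gt_eqF ?subr_gt0.
by rewrite lerD2l ler_pdivrMr.
Qed.

(** For a sample of size [n] the second moments of the ratios multiply. *)
Lemma likelihood_chi2 : 0 <= e ->
  \int[iid_law (coin_law PX) n]_D
    ((likelihood g' D - likelihood g D) ^+ 2 / likelihood g D) <=
  (1 + e) ^+ n - 1.
Proof.
move=> e0.
have bF := @bm_likelihood _ _ _ g n; have bF' := @bm_likelihood _ _ _ g' n.
have bR := bm_tuple_prod n bm_ratio.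
have -> : \int[iid_law (coin_law PX) n]_D
    ((likelihood g' D - likelihood g D) ^+ 2 / likelihood g D) =
  \int[iid_law (coin_law PX) n]_D
    (\prod_(i < n) (density g' (tnth D i) ^+ 2 / density g (tnth D i))
     + ((-2) * likelihood g' D + likelihood g D)).
  apply: eq_Rintegral => D _; have F0 := likelihood_gt0 g D.
  have -> : \prod_(i < n) (density g' (tnth D i) ^+ 2 / density g (tnth D i)) =
      likelihood g' D ^+ 2 / likelihood g D.
    by rewrite big_split/= prodrXl prodfV.
  by field; rewrite gt_eqF.
rewrite meanD//; last by apply: bmD => //; exact: bmZ.
rewrite meanD//; last exact: bmZ.
rewrite meanZ// !mean_likelihood1 (mean_iid_prod (coin_law PX) n bm_ratio).
have /andP[r0 r1] := mean_density_ratio.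
apply: (@le_trans _ _ ((1 + e) ^+ n + (-2 * 1 + 1))); last lra.
by rewrite lerD2r lerXn2r// nnegrE addr_ge0.
Qed.

End likelihood_ratio.

(** * Bayes risk of a random logit *)

Section pointwise.
Context {R : realType}.

(** A quadratic-minus-quartic minorant of the absolute value: it turns lower
    bounds on a mean absolute value into second and fourth moments. *)
Lemma normr_ge_poly (u s : R) : 0 < s ->
  u ^+ 2 / s - u ^+ 4 / (4 * s ^+ 3) <= `|u|.
Proof.
move=> s0; rewrite -[u ^+ 2]real_normK ?num_real//.
have -> : u ^+ 4 = `|u| ^+ 4 by rewrite (exprM u 2 2) (exprM `|u| 2 2) real_normK ?num_real.
set y := `|u| / s; have y0 : 0 <= y by rewrite divr_ge0// ltW.
have uE : `|u| = y * s by rewrite /y divfK// gt_eqF.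
rewrite uE (_ : _ - _ = s * (y ^+ 2 - y ^+ 4 / 4)); last first.
  by field; rewrite gt_eqF.
rewrite [leRHS]mulrC ler_wpM2l ?(ltW s0)//.
have y3 : 0 <= (y - 6/5) ^+ 2 * (y + 12/5) by rewrite mulr_ge0 ?sqr_ge0//; lra.
have : 0 <= 1 - y + y ^+ 3 / 4 by nra.
by move=> /(mulr_ge0 y0); rewrite -subr_ge0; congr (0 <= _); ring.
Qed.

(** The vote [v] disappears: whatever the classifier answers, the average of
    [F_j (|tau_j| - v tau_j)] is at least the gap between the average of
    [F_j |tau_j|] and the modulus of the average of [F_j tau_j]; the rest
    linearizes the signal and bounds that modulus by Young's inequality. *)
Lemma averaged_loss_ge (J : finType) (F u tau : J -> R) (v s t : R) :
  (forall j, 0 < F j) -> 0 < \sum_j F j ->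
  (forall j, `|tau j - u j / 2| <= u j ^+ 2) ->
  `|v| <= 1 -> 0 < s -> 0 < t ->
  (\sum_j F j * u j ^+ 2) / (2 * s) <=
  \sum_j F j * (`|tau j| - v * tau j) + t / 4 * \sum_j F j
  + (\sum_j F j * u j) ^+ 2 / (\sum_j F j) / (4 * t)
  + 2 * \sum_j F j * u j ^+ 2 + (\sum_j F j * u j ^+ 4) / (8 * s ^+ 3).
Proof.
move=> F0; set G := \sum_j F j => G0 tauE v1 s0 t0.
set A := \sum_j F j * u j; set B := \sum_j F j * tau j.
have AB : `|B - A / 2| <= \sum_j F j * u j ^+ 2.
  rewrite /B /A mulr_suml -sumrB (le_trans (ler_norm_sum _ _ _))// ler_sum// => j _.
  by rewrite -mulrA -mulrBr normrM gtr0_norm// ler_wpM2l// ltW.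
have young : `|A| <= (t * G + A ^+ 2 / G / t) / 2.
  rewrite -[A ^+ 2]real_normK ?num_real//.
  have : 0 <= (t * G - `|A|) ^+ 2 / (t * G) by rewrite divr_ge0 ?sqr_ge0// mulr_ge0 ?ltW.
  have -> : (t * G - `|A|) ^+ 2 / (t * G) = t * G + `|A| ^+ 2 / G / t - 2 * `|A|.
    by field; rewrite !gt_eqF.
  lra.
have vB : v * B <= \sum_j F j * u j ^+ 2 + `|A| / 2.
  apply: (le_trans (ler_norm _)); rewrite normrM.
  apply: (@le_trans _ _ `|B|); first by rewrite ler_piMl.
  rewrite -[B in `|B|](subrK (A / 2)) (le_trans (ler_normD _ _))// lerD//.
  by rewrite normrM (@gtr0_norm _ 2^-1).
have tau_ge : (\sum_j F j * u j ^+ 2) / (2 * s)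
    - (\sum_j F j * u j ^+ 4) / (8 * s ^+ 3) - \sum_j F j * u j ^+ 2
    <= \sum_j F j * `|tau j|.
  rewrite !mulr_suml -!sumrB ler_sum// => j _.
  have -> : F j * u j ^+ 2 / (2 * s) - F j * u j ^+ 4 / (8 * s ^+ 3) - F j * u j ^+ 2
    = F j * ((u j ^+ 2 / s - u j ^+ 4 / (4 * s ^+ 3)) / 2 - u j ^+ 2).
    by field; rewrite gt_eqF.
  rewrite ler_wpM2l ?(ltW (F0 j))//.
  have h1 := normr_ge_poly (u j) s0; have h2 := tauE j.
  have : `|u j / 2| <= `|tau j| + `|tau j - u j / 2|.
    rewrite distrC -lerBlDl; exact: lerB_dist.
  by rewrite normrM (@gtr0_norm _ 2^-1)//; lra.
have -> : \sum_j F j * (`|tau j| - v * tau j) = \sum_j F j * `|tau j| - v * B.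
  rewrite /B mulr_sumr -sumrB; apply: eq_bigr => j _; ring.
have e : A ^+ 2 / G / (4 * t) = A ^+ 2 / G / t / 4 by field; rewrite !gt_eqF.
rewrite e; move: vB tau_ge young.
set a1 := (\sum_j F j * u j ^+ 2) / (2 * s).
set a2 := \sum_j F j * u j ^+ 2.
set a3 := (\sum_j F j * u j ^+ 4) / _.
set a4 := A ^+ 2 / G / t; set a5 := t * G.
set a6 := \sum_j F j * `|tau j|; set a7 := v * B.
have -> : t / 4 * G = a5 / 4 by rewrite /a5; ring.
lra.
Qed.

End pointwise.

(* Activity, index and sign of a coordinate.  An inactive coordinate still
   carries an index and a sign, so that the prior is the uniform law on a finite
   product and half of the mass of a coordinate is inactive. *)
Notation activation L := (bool * 'I_L * bool)%type.

Definition sign_of {R : nzRingType} {L} (t : activation L) : R :=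
  if t.1.1 then if t.2 then 1 else -1 else 0.

(** Writing the logit over all pairs [(i, l)] makes it a linear combination of
    functions of [x] that do not depend on the configuration. *)
Definition amplitude {R : nzRingType} {L} (t : activation L) (l : 'I_L) : R :=
  sign_of t * (t.1.2 == l)%:R.

Definition negate {L} (t : activation L) : activation L := (t.1, ~~ t.2).

Lemma normr_sign_of {R : realType} {L} (t : activation L) :
  `|sign_of t : R| <= 1.
Proof.
by rewrite /sign_of; do 2?case: ifP => _; rewrite ?normrN1 ?normr1 ?normr0.
Qed.

Lemma sum_activation {R : nmodType} {L} (G : activation L -> R) :
  \sum_t G t = \sum_l \sum_s G (true, l, s) + \sum_l \sum_s G (false, l, s).
Proof.
transitivity (\sum_(p : bool * 'I_L) \sum_s G (p, s)).
  by rewrite pair_big/=; apply: eq_bigr => -[p s].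
transitivity (\sum_a \sum_l \sum_s G ((a, l), s)); last by rewrite big_bool.
by rewrite [RHS]pair_big/=; apply: eq_bigr => -[a l].
Qed.

Section bayes.
Context {dX} {X : measurableType dX} {R : realType} (PX : probability X R).
Context {I : finType} {L : nat}.
Variables (n : nat) (psi : I -> 'I_L -> {mfun X >-> R}).
Variables (b : I -> X -> R) (beta K : R).
Local Notation config := {ffun I -> activation L}.

Definition random_logit (th : config) (x : X) : R :=
  beta * \sum_i sign_of (th i) * psi i (th i).1.2 x.

Lemma measurable_random_logit th : measurable_fun [set: X] (random_logit th).
Proof.
apply: measurable_funM => //; apply: measurable_sum => i.
exact: measurable_funM.
Qed.

HB.instance Definition _ th :=
  isMeasurableFun.Build _ _ _ _ (random_logit th) (measurable_random_logit th).

Hypotheses (beta_gt0 : 0 < beta) (L_gt0 : (0 < L)%N) (I_gt0 : (0 < #|I|)%N).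
(** The bound [b] depends on [x] in order to exploit disjoint supports: only the
    sum of the squares, at each [x], has to be of the order of [#|I|]. *)
Hypothesis psi_le : forall i l x, `|psi i l x| <= b i x.
Hypothesis b_le : forall i x, beta * b i x <= 1.
Hypothesis sum_b : forall x, \sum_i b i x ^+ 2 <= K * #|I|%:R.
Hypothesis psi_orthonormal : forall i l j m,
  \int[PX]_x (psi i l x * psi j m x) = ((i == j) && (l == m))%:R.

Lemma bm_psi i l : bounded_measurable (psi i l).
Proof.
split => //; exists beta^-1 => x; apply: (le_trans (psi_le i l x)).
by rewrite -div1r ler_pdivlMr// mulrC.
Qed.

Lemma bm_random_logit th : bounded_measurable (random_logit th).
Proof. by apply/bmZ/bm_sum => i _; exact/bmZ/bm_psi. Qed.

Lemma random_logitE th x :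
  random_logit th x = \sum_(p : I * 'I_L) beta * amplitude (th p.1) p.2 * psi p.1 p.2 x.
Proof.
rewrite /random_logit mulr_sumr.
rewrite -(pair_big xpredT xpredT (fun i (l : 'I_L) => beta * amplitude (th i) l * psi i l x))/=.
apply: eq_bigr => i _; rewrite (bigD1 (th i).1.2)//= /amplitude eqxx mulr1 mulrA big1 ?addr0//.
by move=> l /negbTE nl; rewrite eq_sym nl mulr0 mulr0 mul0r.
Qed.

Lemma sum_amplitude2 (t : activation L) : \sum_l amplitude t l ^+ 2 = t.1.1%:R :> R.
Proof.
rewrite /amplitude (bigD1 t.1.2)//= eqxx mulr1 big1 ?addr0; last first.
  by move=> l /negbTE nl; rewrite eq_sym nl mulr0 expr0n.
by rewrite /sign_of; case: t => [[[] ?] []]/=; rewrite ?sqrrN ?expr1n ?expr0n.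
Qed.

(** As the functions of [x] are orthonormal and the weights do not depend on [x],
    the cross terms vanish. *)
Lemma mean_weighted_sqr d (T : measurableType d) (P : probability T R)
    (w : T -> R) (a : I * 'I_L -> T -> R) :
  bounded_measurable w -> (forall p, bounded_measurable (a p)) ->
  \int[(P \x PX)%E]_z (w z.1 * (\sum_p a p z.1 * psi p.1 p.2 z.2) ^+ 2) =
  \sum_p \int[P]_y (w y * a p y ^+ 2).
Proof.
move=> bw ba.
have bpp p q : bounded_measurable (fun x => psi p.1 p.2 x * psi q.1 q.2 x).
  by apply: bmM; exact: bm_psi.
have bwaa p q : bounded_measurable (fun y => w y * (a p y * a q y)).
  by apply: bmM => //; exact: bmM.
have bz p q : bounded_measurable (fun z : T * X =>
    (w z.1 * (a p z.1 * a q z.1)) * (psi p.1 p.2 z.2 * psi q.1 q.2 z.2)).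
  by apply: bmM; [exact: bm_comp measurable_fst (bwaa p q)
    | exact: bm_comp measurable_snd (bpp p q)].
transitivity (\int[(P \x PX)%E]_z \sum_p \sum_q
    ((w z.1 * (a p z.1 * a q z.1)) * (psi p.1 p.2 z.2 * psi q.1 q.2 z.2))).
  apply: eq_Rintegral => z _; rewrite expr2 mulr_suml mulr_sumr.
  apply: eq_bigr => p _; rewrite !mulr_sumr; apply: eq_bigr => q _; ring.
rewrite mean_sum; last by move=> p _; apply: bm_sum => q _.
apply: eq_bigr => p _; rewrite mean_sum//.
rewrite (bigD1 p)//= big1 ?addr0 => [|q qp].
  rewrite (mean_prod_mul _ _ (bwaa p p) (bpp p p)) psi_orthonormal !eqxx mulr1.
  by apply: eq_Rintegral => y _; rewrite expr2.
rewrite (mean_prod_mul _ _ (bwaa p q) (bpp p q)) psi_orthonormal.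
case: (boolP (_ && _)) => [/andP[/eqP e1 /eqP e2]|]; last by rewrite mulr0.
by move: qp; rewrite (surjective_pairing p) (surjective_pairing q) e1 e2 eqxx.
Qed.

Let F (th : config) (D : n.-tuple (X * bool)) := likelihood (random_logit th) D.
Let N : R := #|{ffun I -> activation L}|%:R.
Let sigma2 : R := #|I|%:R * beta ^+ 2.

Let F_gt0 th D : 0 < F th D. Proof. exact: likelihood_gt0. Qed.

Let bF th : bounded_measurable (F th). Proof. exact: bm_likelihood. Qed.

Let card_activation : #|{: activation L}|%:R = 4 * L%:R :> R.
Proof.
by rewrite !card_prod card_ord card_bool -natrM; congr _%:R; lia.
Qed.

Let N_gt0 : 0 < N.
Proof.
rewrite ltr0n; apply/card_gt0P; exists [ffun=> (true, Ordinal L_gt0, true)].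
by [].
Qed.

Let sum_F_gt0 D : 0 < \sum_th F th D.
Proof.
rewrite (bigD1 [ffun=> (true, Ordinal L_gt0, true)])//= ltr_pwDl//.
by apply: sumr_ge0 => th _; exact: ltW.
Qed.

Let sum_active i : \sum_(th : config) (th i).1.1%:R = N / 2 :> R.
Proof.
pose c (th : config) := update th i (~~ (th i).1.1, (th i).1.2, (th i).2).
have cK : involutive c.
  move=> th; rewrite /c update_update update_same/= negbK -!surjective_pairing.
  exact: update_id.
have : \sum_(th : config) (th i).1.1%:R + \sum_(th : config) (th i).1.1%:R = N :> R.
  rewrite {2}(reindex_inj (inv_inj cK))/= -big_split/=.
  rewrite /N -[RHS]mulr1 mulr_natl -sumr_const; apply: eq_bigr => th _.
  by rewrite /c update_same/=; case: ((th i).1.1); rewrite ?addr0 ?add0r.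
lra.
Qed.

Let sum_mean_sqr (P : probability (n.-tuple (X * bool)) R) :
  (forall th, \int[P]_D F th D = 1) ->
  \sum_th \int[(P \x PX)%E]_z (F th z.1 * random_logit th z.2 ^+ 2) =
  N * sigma2 / 2.
Proof.
move=> F1; have E th : \int[(P \x PX)%E]_z (F th z.1 * random_logit th z.2 ^+ 2) =
    \sum_i beta ^+ 2 * (th i).1.1%:R.
  under eq_Rintegral do rewrite random_logitE.
  rewrite (mean_weighted_sqr P (bF th) (fun p => bm_cst (beta * amplitude (th p.1) p.2))).
  rewrite -(pair_big xpredT xpredT (fun i l =>
    \int[P]_y (F th y * (beta * amplitude (th i) l) ^+ 2)))/=.
  apply: eq_bigr => i _; rewrite -sum_amplitude2 mulr_sumr; apply: eq_bigr => l _.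
  under eq_Rintegral do rewrite mulrC.
  by rewrite meanZ// F1 mulr1 exprMn.
under eq_bigr do rewrite E.
rewrite exchange_big/=; under eq_bigr do rewrite -mulr_sumr sum_active.
by rewrite sumr_const -mulr_natl /sigma2; field.
Qed.

Let sum_mean_fourth : \sum_th \int[PX]_x (random_logit th x ^+ 4) <=
  3 * (K * sigma2) ^+ 2 * N.
Proof.
rewrite -mean_sum; last by move=> th _; exact/bmX/bm_random_logit.
rewrite -[leRHS](mean_cst PX); apply: mean_le => [||x].
- by apply: bm_sum => th _; exact/bmX/bm_random_logit.
- exact: bm_cst.
pose Z i (t : activation L) : R := beta * (sign_of t * psi i t.1.2 x).
have Zneg i t : Z i (negate t) = - Z i t.
  by rewrite /Z /negate /sign_of; case: t => [[[] l] []]/=; ring.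
have Zb i t : `|Z i t| <= beta * b i x.
  rewrite /Z normrM gtr0_norm// ler_wpM2l ?(ltW beta_gt0)// normrM.
  by rewrite (le_trans _ (psi_le i t.1.2 x))// ler_piMl// normr_sign_of.
have negK : involutive (@negate L) by case=> [[? ?] ?]; rewrite /negate/= negbK.
have := fourth_moment negK Zneg Zb (index_enum_uniq I).
rewrite (eq_bigr (fun th => random_logit th x ^+ 4)); last first.
  by move=> th _; rewrite /random_logit mulr_sumr.
move=> /le_trans; apply; rewrite ler_wpM2r ?(ltW N_gt0)// ler_wpM2l//.
have VE : \sum_i (beta * b i x) ^+ 2 = beta ^+ 2 * \sum_i b i x ^+ 2.
  by rewrite mulr_sumr; apply: eq_bigr => i _; rewrite exprMn.
have V0 : 0 <= \sum_i (beta * b i x) ^+ 2 by apply: sumr_ge0 => i _; exact: sqr_ge0.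
have VK : \sum_i (beta * b i x) ^+ 2 <= K * sigma2.
  rewrite VE (_ : K * sigma2 = beta ^+ 2 * (K * #|I|%:R)); last by rewrite /sigma2; ring.
  by rewrite ler_wpM2l ?sqr_ge0.
by rewrite ler_sqr// nnegrE (le_trans V0).
Qed.

(** When [i] is inactive its index and sign do not influence the likelihood; [off]
    fixes them arbitrarily, and [on] switches [i] on. *)
Let off th i : config := update th i (false, Ordinal L_gt0, true).

Let on th i l (s : bool) : config := update th i (true, l, s).

Let F_off th i l s : F (update th i (false, l, s)) =1 F (off th i).
Proof.
move=> D; congr (likelihood _ D); apply/funext => x; congr (_ * _).
apply: eq_bigr => j _; rewrite /off !ffunE; case: eqP => // _.
by rewrite /sign_of/= !mul0r.
Qed.

(** Divided by [\sum_th F th D], this is the posterior mean of the coefficient of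
    [psi i l] in the random logit. *)
Let M i l D : R := \sum_(th : config) beta * amplitude (th i) l * F th D.

Let sum_split i (G : config -> R) : 4 * L%:R * \sum_th G th =
  \sum_th \sum_(t : activation L) G (update th i t).
Proof. by rewrite sum_update card_activation. Qed.

Let M_split i l D :
  4 * L%:R * M i l D =
  \sum_th beta * (F (on th i l true) D - F (on th i l false) D).
Proof.
rewrite /M (sum_split i); apply: eq_bigr => th _.
rewrite (eq_bigr (fun t => beta * amplitude t l * F (update th i t) D)); last first.
  by move=> t _; rewrite update_same.
rewrite (bigD1 (true, l, true))//= (bigD1 (true, l, false))/=; last first.
  by rewrite !xpair_eqE eqxx andbF.
rewrite big1 ?addr0; last first.
  move=> [[[] m] s]/=; last by rewrite /amplitude /sign_of/= mul0r mulr0 mul0r.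
  rewrite !xpair_eqE/= => /andP[h1 h2].
  have /negbTE ml : m != l by move: h1 h2; case: s; case: eqP.
  by rewrite /amplitude/= ml mulr0 mulr0 mul0r.
by rewrite /amplitude /sign_of/= eqxx !mulr1 /on; ring.
Qed.

(** Half of the configurations have [i] inactive. *)
Let sum_off_le i D : \sum_th F (off th i) D <= 2 * \sum_th F th D.
Proof.
have L0 : 0 < L%:R :> R by rewrite ltr0n.
rewrite -(ler_pM2l (_ : 0 < 2 * L%:R)) ?mulr_gt0//.
rewrite [leRHS](_ : _ = 4 * L%:R * \sum_th F th D); last by ring.
rewrite (sum_split i) mulr_sumr ler_sum// => th _.
rewrite sum_activation -[leLHS]add0r lerD//.
  by apply: sumr_ge0 => l _; apply: sumr_ge0 => s _; exact: ltW.
rewrite (eq_bigr (fun=> 2 * F (off th i) D)) => [|l _]; last first.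
  by rewrite big_bool/= !F_off; ring.
by rewrite sumr_const card_ord -[leRHS]mulr_natl [leRHS]mulrCA [leRHS]mulrA.
Qed.

Let ratio th i l s D := (F (on th i l s) D - F (off th i) D) ^+ 2 / F (off th i) D.

(** By [M_split], [M i l] is a sum of differences of likelihoods, [i] being switched
    on with either sign.  Cauchy-Schwarz with the weights [F (off th i)] compares
    each with the likelihood where [i] is off; the denominators are absorbed by
    [sum_off_le].  The factor [1 / L^2] is the squared prior weight of the
    index [l]. *)
Let M_sqr_le i l D : M i l D ^+ 2 / \sum_th F th D <=
  beta ^+ 2 / (4 * L%:R ^+ 2) *
  \sum_th (ratio th i l true D + ratio th i l false D).
Proof.
have L0 : 0 < L%:R :> R by rewrite ltr0n.
have Moff0 th : 0 < F (off th i) D by [].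
have := sum_sqr_div_le (fun th => beta * (F (on th i l true) D - F (on th i l false) D)) Moff0.
rewrite -M_split => MM.
rewrite ler_pdivrMr//.
rewrite -(ler_pM2l (_ : 0 < (4 * L%:R) ^+ 2)) ?exprn_gt0 ?mulr_gt0// -exprMn.
apply: (le_trans MM).
set S := \sum_th (ratio _ _ _ _ _ + _).
have S1 : \sum_th (beta * (F (on th i l true) D - F (on th i l false) D)) ^+ 2
    / F (off th i) D <= 2 * beta ^+ 2 * S.
  rewrite /S mulr_sumr ler_sum// => th _; rewrite /ratio -mulrDl mulrA ler_wpM2r ?invr_ge0 ?(ltW (Moff0 _))//.
  set x := F (on _ _ _ true) D; set y := F (on _ _ _ false) D; set z := F (off _ _) D.
  have : 0 <= beta ^+ 2 * ((x - z) + (y - z)) ^+ 2 by rewrite mulr_ge0 ?sqr_ge0.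
  by rewrite -subr_ge0 => h; rewrite -subr_ge0; congr (0 <= _) : h; ring.
have S0 : 0 <= S.
  by apply: sumr_ge0 => th _; rewrite addr_ge0 ?divr_ge0 ?sqr_ge0 ?ltW.
apply: (@le_trans _ _ (2 * beta ^+ 2 * S * (2 * \sum_th F th D))).
  rewrite ler_pM//; last by apply: sumr_ge0 => th _; exact: ltW.
  by apply: sumr_ge0 => th _; rewrite divr_ge0 ?sqr_ge0 ?ltW.
rewrite le_eqVlt; apply/orP; left; apply/eqP; field.
by rewrite gt_eqF.
Qed.

Let P := iid_law (coin_law PX) n.
Let eps : R := (1 + beta ^+ 2) ^+ n - 1.

Let F1 th : \int[P]_D F th D = 1.
Proof. exact: mean_likelihood1. Qed.

Let bm_F_inv th : bounded_measurable (fun D => (F th D)^-1).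
Proof. by apply: bm_likelihood_inv; exact: bm_random_logit. Qed.

Let bm_sum_F : bounded_measurable (fun D => \sum_th F th D).
Proof. by apply: bm_sum => th _. Qed.

Let bm_sum_F_inv : bounded_measurable (fun D => (\sum_th F th D)^-1).
Proof.
pose th0 : config := [ffun=> (true, Ordinal L_gt0, true)].
have [mV [m mF]] := bm_F_inv th0.
have m0 : 0 < `|m| + 1 by rewrite ltr_wpDl.
apply: (@bmV _ _ _ _ (`|m| + 1)^-1); first by rewrite invr_gt0.
  move=> D; apply: (@le_trans _ _ (F th0 D)).
    rewrite -[leRHS]invrK lef_pV2 ?posrE ?invr_gt0//.
    have := mF D; rewrite gtr0_norm ?invr_gt0// => /le_trans; apply.
    by rewrite (le_trans (ler_norm m))// lerDl.
  by rewrite (bigD1 th0)//= lerDl sumr_ge0// => th _; exact: ltW.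
by case: bm_sum_F.
Qed.

Let bm_ratio th i l s : bounded_measurable (ratio th i l s).
Proof. by apply: bmM => //; apply/bmX/bmB. Qed.

Let mean_ratio_le th i l s : \int[P]_D ratio th i l s D <= eps.
Proof.
have diff x : random_logit (on th i l s) x - random_logit (off th i) x =
    beta * ((if s then 1 else -1) * psi i l x).
  rewrite /random_logit -mulrBr; congr (_ * _).
  rewrite (bigD1 i)//= [X in _ - X](bigD1 i)//= /on /off !update_same /sign_of/=.
  rewrite mul0r add0r [X in _ + X - _](eq_bigr (fun j => sign_of (off th i j)
      * psi j (off th i j).1.2 x)) ?addrK// => j ji.
  by rewrite !update_other.
apply: likelihood_chi2; last exact: sqr_ge0.
- exact: bm_random_logit.
- move=> x; rewrite diff normrM gtr0_norm// (le_trans _ (b_le i x))//.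
  rewrite ler_wpM2l ?(ltW beta_gt0)//.
  by rewrite normrM; case: (s) => /=; rewrite ?normrN1 ?normr1 mul1r.
- under eq_Rintegral.
    move=> x _; rewrite diff exprMn.
    rewrite (_ : (_ * _) ^+ 2 = psi i l x * psi i l x); last by case: (s); ring.
    over.
  rewrite meanZ; last by apply: bmM; exact: bm_psi.
  by rewrite psi_orthonormal !eqxx mulr1.
Qed.

Let bm_M i l : bounded_measurable (M i l).
Proof. by apply: bm_sum => th _; exact: bmZ. Qed.

Let mean_M_le i l :
  \int[P]_D ((\sum_th F th D)^-1 * M i l D ^+ 2) <=
  beta ^+ 2 / (2 * L%:R ^+ 2) * (N * eps).
Proof.
have L0 : 0 < L%:R :> R by rewrite ltr0n.
have b2 : bounded_measurable (fun D => \sum_th (ratio th i l true D + ratio th i l false D)).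
  by apply: bm_sum => th _; exact: bmD.
apply: (@le_trans _ _ (\int[P]_D (beta ^+ 2 / (4 * L%:R ^+ 2) *
    \sum_th (ratio th i l true D + ratio th i l false D)))).
  apply: mean_le => [||D]; [by apply: bmM => //; exact: bmX|exact: bmZ|].
  by rewrite mulrC; exact: M_sqr_le.
rewrite meanZ//.
have -> : beta ^+ 2 / (2 * L%:R ^+ 2) * (N * eps) =
    beta ^+ 2 / (4 * L%:R ^+ 2) * (N * (eps + eps)) by field; rewrite gt_eqF.
rewrite ler_wpM2l ?divr_ge0 ?sqr_ge0 ?mulr_ge0 ?sqr_ge0//.
rewrite mean_sum; last by move=> th _; exact: bmD.
rewrite /N mulr_natl -sumr_const ler_sum// => th _.
by rewrite meanD// lerD.
Qed.

(** Orthonormality reduces the posterior mean of the logit to its [#|I| * L]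
    coefficients, each of them of order [beta^2 eps / L^2]. *)
Let mean_posterior_le :
  \int[(P \x PX)%E]_z
     ((\sum_th F th z.1)^-1 * (\sum_th F th z.1 * random_logit th z.2) ^+ 2) <=
  N * sigma2 * (eps / (2 * L%:R)).
Proof.
have L0 : 0 < L%:R :> R by rewrite ltr0n.
have E z : \sum_th F th z.1 * random_logit th z.2 =
    \sum_(p : I * 'I_L) M p.1 p.2 z.1 * psi p.1 p.2 z.2.
  under eq_bigr do rewrite random_logitE mulr_sumr.
  rewrite exchange_big/=; apply: eq_bigr => p _; rewrite /M mulr_suml.
  by apply: eq_bigr => th _; ring.
under eq_Rintegral do rewrite E.
rewrite (mean_weighted_sqr P bm_sum_F_inv (fun p => bm_M p.1 p.2)).
apply: (@le_trans _ _ (\sum_(p : I * 'I_L) beta ^+ 2 / (2 * L%:R ^+ 2) * (N * eps))).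
  by apply: ler_sum => p _; exact: mean_M_le.
rewrite sumr_const card_prod card_ord -[leLHS]mulr_natl natrM /sigma2 le_eqVlt.
by apply/orP; left; apply/eqP; field; rewrite gt_eqF.
Qed.

(** Some configuration does at least as badly as the average.  The average is
    bounded below by integrating [averaged_loss_ge]. *)
Lemma random_logit_excess (v : n.-tuple (X * bool) * X -> bool) :
  measurable_fun [set: n.-tuple (X * bool) * X] v ->
  1 <= K -> eps <= L%:R / (128 * K ^+ 2) -> Num.sqrt sigma2 <= (64 * K)^-1 ->
  exists th, Num.sqrt sigma2 / (64 * K) <=
    \int[iid_law (labelled_law PX (random_logit th)) n]_D \int[PX]_x
     ((`|signal (random_logit th x)| - vote (v (D, x)) * signal (random_logit th x)) / 2).
Proof.
move=> mv K1 eps_le sigma_le; set sigma := Num.sqrt sigma2 in sigma_le *.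
have s2_gt0 : 0 < sigma2 by rewrite /sigma2 mulr_gt0 ?exprn_gt0// ltr0n.
have sigma_gt0 : 0 < sigma by rewrite sqrtr_gt0.
have sE : sigma2 = sigma ^+ 2 by rewrite sqr_sqrtr// ltW.
pose Ex th := \int[iid_law (labelled_law PX (random_logit th)) n]_D \int[PX]_x
  ((`|signal (random_logit th x)| - vote (v (D, x)) * signal (random_logit th x)) / 2).
suff sumEx : N * (sigma / (64 * K)) <= \sum_th Ex th.
  apply: contrapT => /forallNP Exlt.
  have : \sum_th Ex th < \sum_(th : config) sigma / (64 * K).
    apply: ltr_sum => [|th _]; last by rewrite ltNge; apply/negP; exact: Exlt.
    by apply/hasP; exists [ffun=> (true, Ordinal L_gt0, true)] => //; exact: mem_index_enum.
  by rewrite sumr_const -[ltRHS]mulr_natl ltNge sumEx.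
pose Q : probability _ R := (P \x PX)%E.
pose A (z : n.-tuple (X * bool) * X) : R := \sum_th F th z.1 * (`|signal (random_logit th z.2)| -
  vote (v z) * signal (random_logit th z.2)).
pose D2 (z : n.-tuple (X * bool) * X) : R := \sum_th F th z.1 * random_logit th z.2 ^+ 2.
pose D4 (z : n.-tuple (X * bool) * X) : R := \sum_th F th z.1 * random_logit th z.2 ^+ 4.
pose B (z : n.-tuple (X * bool) * X) : R := \sum_th F th z.1.
pose C (z : n.-tuple (X * bool) * X) : R := (\sum_th F th z.1)^-1 * (\sum_th F th z.1 * random_logit th z.2) ^+ 2.
have bFz th := bm_comp (@measurable_fst _ _ _ X) (bF th).
have buz th := bm_comp (@measurable_snd _ _ (n.-tuple (X * bool)) _) (bm_random_logit th).
have btz th : bounded_measurable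
    (fun z : n.-tuple (X * bool) * X => signal (random_logit th z.2)).
  exact: bm_comp measurable_snd (bm_signal (random_logit th)).
have bAth th : bounded_measurable (fun z => F th z.1 *
    (`|signal (random_logit th z.2)| - vote (v z) * signal (random_logit th z.2))).
  apply: bmM => //; apply: bmB; first exact: bm_norm.
  by apply: bmM => //; exact: bm_vote.
have bA : bounded_measurable A by apply: bm_sum => th _.
have bD2 : bounded_measurable D2.
  by apply: bm_sum => th _; apply: bmM => //; exact: bmX.
have bD4 : bounded_measurable D4.
  by apply: bm_sum => th _; apply: bmM => //; exact: bmX.
have bB : bounded_measurable B by apply: bm_sum => th _.
have bC : bounded_measurable C.
  apply: bmM; first exact: bm_comp measurable_fst bm_sum_F_inv.
  by apply: bmX; apply: bm_sum => th _; exact: bmM.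
have EA : \int[Q]_z A z = 2 * \sum_th Ex th.
  rewrite (mean_sum Q _ (fun th _ => bAth th)) mulr_sumr; apply: eq_bigr => th _.
  have bx D : bounded_measurable (fun x => `|signal (random_logit th x)| -
      vote (v (D, x)) * signal (random_logit th x)).
    apply: (bm_section (f := fun z => `|signal (random_logit th z.2)| -
      vote (v z) * signal (random_logit th z.2))).
    by apply: bmB; [exact: bm_norm | apply: bmM => //; exact: bm_vote].
  have bH : bounded_measurable (fun D => \int[PX]_x
      ((`|signal (random_logit th x)| - vote (v (D, x)) * signal (random_logit th x)) / 2)).
    have bZ : bounded_measurable (fun z : n.-tuple (X * bool) * X =>
      (`|signal (random_logit th z.2)| - vote (v z) * signal (random_logit th z.2)) / 2).
      apply: bmM (bm_cst 2^-1); apply: bmB; first exact: bm_norm.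
      by apply: bmM => //; exact: bm_vote.
    exact: (bm_mean_section P PX bZ).
  rewrite /Q mean_prod// /Ex (mean_likelihood PX _ bH) -meanZ; last exact: bmM (bF th) bH.
  apply: eq_Rintegral => D _; apply: (etrans (meanZ PX (F th D) (bx D))).
  under [in RHS]eq_Rintegral do rewrite mulrC.
  by rewrite [X in 2 * (_ * X)](meanZ PX 2^-1 (bx D)) /F; field.
have EB : \int[Q]_z B z = N.
  rewrite (mean_sum Q _ (fun th _ => bFz th)) /N -[RHS]mulr1 mulr_natl -sumr_const; apply: eq_bigr => th _.
  have := mean_prod_mul P PX (bF th) (bm_cst 1).
  by rewrite mean_cst mulr1 F1 => <-; apply: eq_Rintegral => z _; rewrite mulr1.
have ED2 : \int[Q]_z D2 z = N * sigma2 / 2.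
  rewrite mean_sum; first exact: sum_mean_sqr.
  by move=> th _; apply: bmM => //; exact: bmX.
have ED4 : \int[Q]_z D4 z <= 3 * (K * sigma2) ^+ 2 * N.
  rewrite mean_sum; last by move=> th _; apply: bmM => //; exact: bmX.
  rewrite (eq_bigr (fun th => \int[PX]_x (random_logit th x ^+ 4))) => [|th _].
    exact: sum_mean_fourth.
  rewrite (mean_prod_mul P PX (bF th) (bmX 4 (bm_random_logit th))).
  by rewrite F1 mul1r.
have EC : \int[Q]_z C z <= N * sigma2 * (eps / (2 * L%:R)) := mean_posterior_le.
(* In the unit [c] below, the main term of [averaged_loss_ge] is 8, and the four
   error terms are at most 1, 1, 1 and 3: [s] balances the second moment with the
   fourth, [t] makes the first two errors equal.  The remaining 2 is halved by
   the factor 1/2 of the loss. *)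
pose s := 2 * K * sigma; pose t := sigma / (16 * K).
have K0 : 0 < K by exact: lt_le_trans K1.
have s0 : 0 < s by rewrite !mulr_gt0.
have t0 : 0 < t by rewrite divr_gt0// mulr_gt0.
have key : (2 * s)^-1 * \int[Q]_z D2 z <=
    \int[Q]_z A z + t / 4 * \int[Q]_z B z + (4 * t)^-1 * \int[Q]_z C z
    + 2 * \int[Q]_z D2 z + (8 * s ^+ 3)^-1 * \int[Q]_z D4 z.
  have b1 := bmD bA (bmZ (t / 4) bB).
  have b2 := bmD b1 (bmZ (4 * t)^-1 bC).
  have b3 := bmD b2 (bmZ 2 bD2).
  have b4 := bmD b3 (bmZ (8 * s ^+ 3)^-1 bD4).
  rewrite -!meanZ// -(meanD Q bA (bmZ (t / 4) bB)) -(meanD Q b1 (bmZ (4 * t)^-1 bC)).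
  rewrite -(meanD Q b2 (bmZ 2 bD2)) -(meanD Q b3 (bmZ (8 * s ^+ 3)^-1 bD4)).
  apply: mean_le => [||z]; [exact: bmZ|exact: b4|].
  have v1 : `|vote (v z) : R| <= 1 by rewrite /vote; case: ifP; rewrite ?normrN1 ?normr1.
  have := averaged_loss_ge (fun th => F_gt0 th z.1) (sum_F_gt0 z.1)
    (fun th => signal_linear (random_logit th z.2)) v1 s0 t0.
  rewrite -/(A z) -/(B z) -/(D2 z) -/(D4 z).
  rewrite [D2 z / _]mulrC [D4 z / _]mulrC; congr (_ <= _ + _ + _ + _ + _).
  by rewrite /C [LHS]mulrC; congr (_ * _); rewrite mulrC.
have L0 : 0 < L%:R :> R by rewrite ltr0n.
pose c := N * sigma / (64 * K).
have c1 : (2 * s)^-1 * \int[Q]_z D2 z = 8 * c.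
  by rewrite ED2 sE /c /s; field; rewrite !gt_eqF.
have c2 : t / 4 * \int[Q]_z B z = c by rewrite EB /c /t; field; rewrite gt_eqF.
have c3 : (4 * t)^-1 * \int[Q]_z C z <= c.
  have -> : c = (4 * t)^-1 * (N * sigma2 * (256 * K ^+ 2)^-1).
    by rewrite /c /t sE; field; rewrite !gt_eqF.
  have t4 : 0 <= (4 * t)^-1 by rewrite invr_ge0 mulr_ge0// ltW.
  apply: (ler_wpM2l t4); apply: (le_trans EC).
  apply: ler_wpM2l; first by rewrite mulr_ge0 ?(ltW s2_gt0) ?(ltW N_gt0).
  rewrite ler_pdivrMr ?mulr_gt0// (le_trans eps_le)// le_eqVlt.
  by apply/orP; left; apply/eqP; field; rewrite gt_eqF.
have c4 : 2 * \int[Q]_z D2 z <= c.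
  rewrite ED2 mulrCA mulfV ?mulr1 ?pnatr_eq0// sE /c -mulrA ler_wpM2l ?(ltW N_gt0)//.
  by rewrite expr2 ler_wpM2l ?(ltW sigma_gt0).
have c5 : (8 * s ^+ 3)^-1 * \int[Q]_z D4 z <= 3 * c.
  have -> : 3 * c = (8 * s ^+ 3)^-1 * (3 * (K * sigma2) ^+ 2 * N).
    by rewrite /c /s sE; field; rewrite !gt_eqF.
  have s8 : 0 <= (8 * s ^+ 3)^-1 by rewrite invr_ge0 mulr_ge0// exprn_ge0// ltW.
  by apply: (ler_wpM2l s8); exact: ED4.
rewrite mulrA -/c; move: key; rewrite c1 c2 EA; lra.
Qed.

End bayes.

(** * Independent uniform features *)

Section coordinates.
Context d (T : measurableType d) (R : realType) (P : probability T R).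
Implicit Types f g : T -> R.

Lemma bm_tnth n (i : 'I_n) f : bounded_measurable f ->
  bounded_measurable (fun x : n.-tuple T => f (tnth x i)).
Proof. by move=> bf; apply: bm_comp bf; exact: measurable_tnth. Qed.

Lemma mean_tnth n (i : 'I_n) f : bounded_measurable f ->
  \int[iid_law P n]_x f (tnth x i) = \int[P]_t f t.
Proof.
move=> bf; elim: n i => [[]//|n IH] i.
rewrite (mean_iidS P (bm_tnth i bf)).
case: (unliftP ord0 i) => [j ->|->].
  rewrite -[RHS](mean_cst P); apply: eq_Rintegral => t _.
  rewrite -(IH j); apply: eq_Rintegral => x _; congr f.
  exact: tnthS.
apply: eq_Rintegral => t _; rewrite -[RHS](mean_cst (iid_law P n)).
by apply: eq_Rintegral => x _.
Qed.

Lemma mean_tnth2 n (i j : 'I_n) f g : i != j ->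
  bounded_measurable f -> bounded_measurable g ->
  \int[iid_law P n]_x (f (tnth x i) * g (tnth x j)) =
  (\int[P]_t f t) * \int[P]_t g t.
Proof.
move=> ij bf bg; wlog : i j f g ij bf bg / (i < j)%N.
  move=> H; have [ltij|ltji|eqij] := ltngtP i j.
  - exact: H.
  - rewrite mulrC -(H j i)//; last by rewrite eq_sym.
    by apply: eq_Rintegral => x _; rewrite mulrC.
  - by move: ij; rewrite (val_inj eqij) eqxx.
elim: n i j ij => [[]//|n IH] i j ij ltij.
have bfg := bmM (bm_tnth i bf) (bm_tnth j bg).
rewrite (mean_iidS P bfg).
case: (unliftP ord0 j) ltij ij => [j' ->|-> //] ltij ij.
case: (unliftP ord0 i) ltij ij => [i' ->|->] ltij ij.
  rewrite -[RHS](mean_cst P); apply: eq_Rintegral => t _.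
  rewrite -(IH i' j'); last 2 first.
  - by move: ij; rewrite (inj_eq lift_inj).
  - by move: ltij; rewrite /= /bump /= !add1n.
  by apply: eq_Rintegral => x _; congr (f _ * g _); exact: tnthS.
rewrite mulrC -meanZ//; apply: eq_Rintegral => t _.
rewrite mulrC -(mean_tnth j' bg) -meanZ; last exact: bm_tnth.
apply: eq_Rintegral => x _; congr (_ * g _).
exact: tnthS.
Qed.

End coordinates.

Section uniform_features.
Context {R : realType} (d : nat).
Notation U := (@uniform01 R).
Notation PX := (iid_law U d).

Lemma iid_marginal (j : 'I_d) (A : set R) : measurable A ->
  PX [set x | A (tnth x j)] = U A.
Proof.
move=> mA; have mA' : measurable [set x : d.-tuple R | A (tnth x j)].
  by rewrite -[mkset _]setTI; exact: (measurable_tnth j).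
rewrite !probability_mean// -(mean_tnth U j (bm_indic R mA)).
by congr EFin; apply: eq_Rintegral => x _; rewrite !indicE.
Qed.

(** [clip] replaces the unbounded identity by a function equal to it on [0, 1];
    [low] is centered and negatively correlated with the coordinate. *)
Let clip (t : R) : R := Num.max 0 (Num.min t 1).

Let bm_clip : bounded_measurable clip.
Proof.
split; first by apply: measurable_maxr => //; exact: measurable_minr.
exists 1 => x; rewrite /clip; have [|] := leP x 1; have [|] := leP 0 x => *;
  rewrite ger0_norm ?le_max ?ge_max ?lexx ?ler01//; lra.
Qed.

Let low (t : R) : R := (t <= 2^-1)%R%:R - 2^-1.

Let bm_le p : bounded_measurable (fun t : R => (t <= p)%R%:R : R).
Proof.
have -> : (fun t : R => (t <= p)%R%:R : R) = \1_`]-oo, p].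
  by apply/funext => t; rewrite indicE mem_setE in_itv.
exact: bm_indic.
Qed.

Let bm_low : bounded_measurable low.
Proof. exact: bmB (bm_le _) (bm_cst _). Qed.

Let mean_low : \int[U]_t low t = 0.
Proof. by rewrite meanB// ?mean_cst ?mean_uniform_le ?subrr//; [lra|exact: bm_cst]. Qed.

Let mean_clip_low : \int[U]_t (clip t * low t) < 0.
Proof.
have -> : \int[U]_t (clip t * low t) = \int[U]_t ((clip t - 2^-1) * low t).
  transitivity (\int[U]_t (clip t * low t - 2^-1 * low t)).
    rewrite meanB ?meanZ ?mean_low ?mulr0 ?subr0//; [exact: bmM|exact: bmZ].
  by apply: eq_Rintegral => t _; rewrite mulrBl.
apply: (@le_lt_trans _ _ (\int[U]_t (- 8^-1 * (t <= 4^-1)%R%:R))).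
  apply: mean_le => [||t].
  - by apply: bmM => //; exact: bmB bm_clip (bm_cst _).
  - exact: bmZ.
  rewrite /low /clip maxEle minEle.
  by case: (leP t 1) => ?; case: (leP 0) => ?; case: (leP t (2^-1)) => ?;
    case: (leP t (4^-1)) => ? /=; rewrite ?mulr1 ?mulr0 ?mulr1n ?mulr0n; lra.
by rewrite meanZ// mean_uniform_le; lra.
Qed.

(** If [\sum_j a_j x_j] vanishes almost surely, so does its covariance with
    [low (x_k)], to which only the term of [a_k] contributes by independence. *)
Lemma feature_law_uniform : feature_law PX.
Proof.
have mcube : measurable [set x : d.-tuple R | forall j, 0 <= tnth x j <= 1].
  rewrite (_ : mkset _ = \bigcap_(j in [set: 'I_d])
      (fun x : d.-tuple R => tnth x j) @^-1` `[0, 1]%classic).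
    apply: fin_bigcap_measurable => // j _; rewrite -[_ @^-1` _]setTI.
    by apply: (measurable_tnth j) => //; exact: measurable_itv.
  apply/seteqP; split => x /=.
    by move=> x01 j _ /=; rewrite in_itv/=.
  by move=> x01 j; have := x01 j I; rewrite /= in_itv.
have cube1 : PX [set x | forall j, 0 <= tnth x j <= 1] = 1%E.
  rewrite probability_mean//; congr EFin.
  have bI : bounded_measurable (\1_`[0, 1] : R -> R) by exact: bm_indic.
  have := mean_iid_prod U d bI.
  have -> : \int[U]_t \1_`[0, 1] t = 1.
    rewrite mean_uniform// -[RHS]Rintegral01_cst; apply: eq_Rintegral => t t01.
    by rewrite indicE t01.
  rewrite expr1n.
  move=> E; rewrite -[RHS]E; apply: eq_Rintegral => x _; rewrite indicE.
  have [/set_mem/= x01|/negP x01] := boolP (x \in _).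
    by rewrite big1// => j _; rewrite indicE mem_setE in_itv/= x01.
  have [j xj] : exists j, ~~ (0 <= tnth x j <= 1).
    apply: contrapT => /forallNP H; apply: x01; apply/mem_set => j /=.
    by apply: contrapT => /negP; exact: H.
  by rewrite (bigD1 j)//= indicE mem_setE in_itv/= (negbTE xj) mul0r.
split => // [a a0 k|j].
  have msum : measurable_fun setT (fun x : d.-tuple R => \sum_(j < d) a j * tnth x j).
    by apply: measurable_sum => j; apply: measurable_funM => //; exact: measurable_tnth.
  set A := [set x : d.-tuple R | _] in a0.
  have mA : measurable A.
    rewrite -[A]setTI; exact: (msum measurableT _ (measurable_set1 0)).
  set cube := [set x : d.-tuple R | _] in mcube cube1.
  pose h (x : d.-tuple R) := \sum_(j < d) a j * (clip (tnth x j) * low (tnth x k)).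
  have bh : bounded_measurable h.
    by apply: bm_sum => j _; apply/bmZ/bmM; exact: bm_tnth.
  have h0 : \int[PX]_x h x = 0.
    have [_ [M hM]] := bh.
    have bC B : measurable B -> bounded_measurable (fun x : d.-tuple R => 1 - \1_B x : R).
      by move=> mB; apply: bmB (bm_cst 1) _; exact: bm_indic.
    have null B : measurable B -> PX B = 1%E -> \int[PX]_x (1 - \1_B x) = 0.
      move=> mB; rewrite probability_mean// => -[B1].
      by rewrite meanB ?mean_cst ?B1 ?subrr//; [exact: bm_cst|exact: bm_indic].
    have bN := bmZ M (bmD (bC _ mA) (bC _ mcube)).
    have hN x : `|h x| <= M * ((1 - \1_A x) + (1 - \1_cube x)).
      have M0 : 0 <= M by rewrite (le_trans _ (hM x)).
      rewrite !indicE.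
      have [/set_mem Ax|nA] := boolP (x \in A); last first.
        rewrite subr0 (le_trans (hM x))// ler_peMr// lerDl.
        by case: (_ \in _); rewrite ?subrr ?subr0.
      have [/set_mem cx|nc] := boolP (x \in cube); last first.
        by rewrite subr0 subrr add0r mulr1.
      rewrite /h (eq_bigr (fun j => a j * tnth x j * low (tnth x k))) => [|j _].
        have {}Ax : \sum_(j < d) a j * tnth x j = 0 := Ax.
        by rewrite -mulr_suml Ax mul0r normr0 !subrr addr0 mulr0.
      rewrite mulrA; congr (_ * _ * _); have /andP[x0 x1] := cx j.
      by rewrite /clip min_l// max_r.
    apply/eqP; rewrite -normr_le0.
    apply: (@le_trans _ _ (\int[PX]_x `|h x|)).
      by apply: le_normr_Rintegral => //; exact: bm_integrable.
    rewrite (_ : 0 = \int[PX]_x (M * ((1 - \1_A x) + (1 - \1_cube x)))).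
      by apply: mean_le => //; exact: bm_norm.
    rewrite (meanZ PX M (bmD (bC _ mA) (bC _ mcube))).
    by rewrite (meanD PX (bC _ mA) (bC _ mcube)) !null// addr0 mulr0.
  have bj j : bounded_measurable (fun x : d.-tuple R => clip (tnth x j) * low (tnth x k)).
    by apply: bmM; exact: bm_tnth.
  move: h0; rewrite mean_sum => [|j _]; last exact: bmZ.
  rewrite (bigD1 k)//= big1 ?addr0 => [|j jk]; last first.
    by rewrite meanZ// (mean_tnth2 U jk bm_clip bm_low) mean_low !mulr0.
  rewrite meanZ//; have -> := mean_tnth U k (bmM bm_clip bm_low).
  by move=> /eqP; rewrite mulf_eq0 (lt_eqF mean_clip_low) orbF => /eqP.
move=> A A0 B mB BA; have -> := iid_marginal j mB.
have /null_content_dominatesP := dominates_uniform_prob (@ltr01 R).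
by apply => //; exact: A0.
Qed.

End uniform_features.

(** * Interior wavelets *)

Section compact_support.
Context {R : realType}.
Notation mu := (@lebesgue_measure R).

Lemma bm_compact_support (f : R -> R) (a b : R) : continuous f ->
  (forall t, t < a \/ b < t -> f t = 0) -> bounded_measurable f.
Proof.
move=> cf f0; split; first exact: continuous_measurable_fun.
have cab : {within `[a, b], continuous f} by exact: continuous_subspaceT.
have cpt := continuous_compact cab (@segment_compact R a b).
have [M [_ Mf]] := compact_bounded cpt.
exists (`|M| + 1) => x.
have [xab|xab] := boolP (x \in `[a, b]%R).
  by apply: (Mf (`|M| + 1)); [rewrite ltr_pwDr// ler_norm | exists x].
rewrite f0 ?normr0 ?addr_ge0//.
by move: xab; rewrite in_itv/= negb_and -!ltNge => /orP.
Qed.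

Lemma bm_dilate (f : R -> R) h k : bounded_measurable f ->
  bounded_measurable (dilate f h k).
Proof.
move=> bf; apply/bmZ; apply: (bm_comp (h := fun t : R => 2 ^+ h * t - k%:~R)) bf.
by apply: measurable_funB => //; exact: measurable_funM.
Qed.

Lemma dilate_support (f : R -> R) (n h : nat) (k : int) (t : R) :
  (forall u, u < 1 - n%:R \/ n%:R < u -> f u = 0) ->
  2 ^+ h * t < k%:~R + 1 - n%:R \/ k%:~R + n%:R < 2 ^+ h * t ->
  dilate f h k t = 0.
Proof.
by move=> f0 tk; rewrite /dilate f0 ?mulr0//; case: tk => tk; [left|right]; lra.
Qed.

(** Change of variable: the dilate has the same mean as [f] up to a factor as
    soon as its support lies in the unit interval. *)
Lemma dilate_mean0 (f : R -> R) (n h k : nat) : continuous f ->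
  (forall u, u < 1 - n%:R \/ n%:R < u -> f u = 0) ->
  \int[mu]_t f t = 0 -> (n <= k)%N -> (k + n <= 2 ^ h)%N ->
  \int[mu]_(t in `[0%R, 1%R]) dilate f h k%:Z t = 0.
Proof.
move=> cf f0 If nk kn.
have bf : bounded_measurable f by exact: bm_compact_support f0.
pose F (t : R) := 2 ^+ h * t - k%:R.
have p0 : 0 < 2 ^+ h :> R by rewrite exprn_gt0.
have dF (t : R) : is_derive t (1 : R) F (2 ^+ h).
  have -> : F = (2 ^+ h \*: (@id R)) - cst k%:R by [].
  by apply: is_derive_eq; rewrite subr0 /GRing.scale/= mulr1.
have F'E : derive1 F = cst (2 ^+ h) by apply/funext => t; rewrite derive1E; exact: derive_val.
have H : (\int[mu]_(x in `[F 0%R, F 1%R]) (f x)%:E =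
  \int[mu]_(x in `[0%R, 1%R]) (((f \o F) * derive1 F)%R x)%:E)%E.
  apply: integration_by_substitution_increasing => //.
  - by move=> x y _ _ xy; rewrite /F ltrD2r ltr_pM2l.
  - by rewrite F'E => x _; exact: cst_continuous.
  - by rewrite F'E; exact: is_cvg_cst.
  - by rewrite F'E; exact: is_cvg_cst.
  - have cF : continuous F by move=> t; apply: differentiable_continuous; apply/derivable1_diffP; exact: ex_derive.
    split => [x _||]; first exact: ex_derive.
      by apply: cvg_at_right_filter; exact: cF.
    by apply: cvg_at_left_filter; exact: cF.
  - exact: continuous_subspaceT.
have {}H : \int[mu]_(x in `[F 0, F 1]) f x =
    \int[mu]_(t in `[0, 1]) (f (F t) * 2 ^+ h).
  by rewrite /Rintegral H; congr fine; apply: eq_integral => t _; rewrite F'E.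
have F0 : F 0 = - k%:R by rewrite /F mulr0 sub0r.
have F1 : F 1 = 2 ^+ h - k%:R by rewrite /F mulr1.
have F01 : \int[mu]_(x in `[F 0, F 1]) f x = 0.
  rewrite -[RHS]If Rintegral_mkcond; apply: eq_Rintegral => t _.
  rewrite patchE; case: ifPn => // tF; rewrite f0//.
  move: tF; rewrite notin_setE/= in_itv/= F0 F1 => /negP.
  rewrite negb_and -!ltNge => /orP; move: nk kn.
  rewrite -!(ler_nat R) natrD natrX => nk kn [?|?]; [left|right]; lra.
have bF : bounded_measurable (fun t => f (F t)).
  apply: bm_comp bf; rewrite /F.
  by apply: measurable_funB => //; exact: measurable_funM.
transitivity (\int[mu]_(t in `[0, 1]) ((Num.sqrt (2 ^+ h) / 2 ^+ h) * (f (F t) * 2 ^+ h))).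
  apply: eq_Rintegral => t _; rewrite /dilate /F.
  by field; rewrite gt_eqF.
rewrite RintegralZl// -?H ?F01 ?mulr0//.
by apply: (bounded_integrable01 (f := fun t => f (F t) * 2 ^+ h)); exact: bmM bF (bm_cst _).
Qed.

End compact_support.

Section interior_wavelets.
Context {R : realType} {r : nat} (W : cdv_wavelets R r).
Notation mu := (@lebesgue_measure R).
Let N := cdv_size W.
Let phi := cdv_scaling W.
Let psi := cdv_mother W.
Let mw : scaling_wavelet r N phi psi := cdv_mother_wavelet W.

Lemma continuous_scaling : continuous phi.
Proof. exact: (scaling_smooth_cont mw (leq0n r)). Qed.

Lemma bm_scaling : bounded_measurable phi.
Proof. exact: bm_compact_support continuous_scaling (scaling_support mw). Qed.

(** Through the filter, the mother wavelet is a finite combination of dilates of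
    the scaling function. *)
Lemma continuous_mother : continuous psi.
Proof.
have [a [_ psiE]] := scaling_filter mw.
rewrite (_ : psi = fun t => Num.sqrt 2 *
       \sum_(i < N.*2) (-1) ^ (shiftN N i) * a (1 - shiftN N i) *
                       phi (2 * t - (shiftN N i)%:~R)); last exact/funext.
move=> u; apply: cvgM; first exact: cvg_cst.
move: u; apply: continuous_big => [|i _ u]; first exact: add_continuous.
apply: cvgM; first exact: cvg_cst.
apply: (@continuous_comp _ _ _ (fun t : R => 2 * t - (shiftN N i)%:~R) phi).
  by apply: cvgB; [apply: cvgM; [exact: cvg_cst|exact: cvg_id] | exact: cvg_cst].
exact: continuous_scaling.
Qed.

Lemma mother_support t : t < 1 - N%:R \/ N%:R < t -> psi t = 0.
Proof.
move=> tN; have [a [_ ->]] := scaling_filter mw.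
rewrite big1 ?mulr0// => -[i /= iN] _; rewrite (scaling_support mw) ?mulr0//.
move: iN; rewrite -(ler_nat R) -addnn natrD -natr1 => iN.
have -> : (shiftN N i)%:~R = i%:R + 1 - N%:R :> R by rewrite /shiftN rmorphB rmorphD.
by have := ler0n R i; case: tN => ? ?; [left|right]; lra.
Qed.

Lemma bm_mother : bounded_measurable psi.
Proof. exact: bm_compact_support continuous_mother mother_support. Qed.

Lemma mother_mean0 : \int[mu]_t psi t = 0.
Proof.
rewrite -(wavelet_moments mw (scaling_size_gt0 mw)).
by apply: eq_Rintegral => t _; rewrite expr0 mul1r.
Qed.

Lemma mra_bounded n h (f : R -> R) : interval_mra n phi h f ->
  exists2 G : R -> R, bounded_measurable G & forall t, 0 <= t <= 1 -> f t = G t.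
Proof.
move=> [c [_ [_ [_ _ _ fE]]]]; eexists; last exact: fE.
by apply: bm_sum => i _; apply/bmZ/bm_dilate/bm_scaling.
Qed.

Definition wavelet h k (t : R) := dilate psi h k%:Z t.

(** The wavelets whose support lies in the unit interval, where the basis
    function is the dilated mother wavelet itself. *)
Definition interior h k :=
  [&& (cdv_coarse W <= h)%N, (N <= k)%N & (k + N < 2 ^ h)%N].

Lemma interior_lt h k : interior h k -> (k < 2 ^ h)%N.
Proof. by move=> /and3P[_ _]; apply: leq_ltn_trans; exact: leq_addr. Qed.

Lemma bm_wavelet h k : bounded_measurable (wavelet h k).
Proof. exact/bm_dilate/bm_mother. Qed.

Lemma wavelet_basis h k t : interior h k -> 0 <= t <= 1 ->
  wavelet h k t = cdv_basis W h k t.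
Proof. by move=> /and3P[h0 Nk kN] t01; rewrite (cdv_interior h0 Nk kN t01). Qed.

Lemma mean_wavelet h k : interior h k -> \int[uniform01]_t wavelet h k t = 0.
Proof.
move=> /and3P[_ Nk kN]; rewrite mean_uniform; last exact: bm_wavelet.
apply: (dilate_mean0 continuous_mother mother_support mother_mean0 Nk).
exact: ltnW.
Qed.

Lemma inner01_mean (f g G : R -> R) :
  bounded_measurable f -> bounded_measurable G ->
  (forall t, 0 <= t <= 1 -> g t = G t) ->
  inner01 f g = \int[uniform01]_t (f t * G t).
Proof.
move=> bf bG gG; rewrite mean_uniform; last exact: bmM.
by apply: eq_Rintegral => t; rewrite inE/= in_itv/= => t01; rewrite gG.
Qed.

Lemma inner01_wavelet h k h' k' : interior h k -> (k' < 2 ^ h')%N ->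
  inner01 (wavelet h k) (cdv_basis W h' k') = ((h == h') && (k == k'))%:R.
Proof.
move=> hk k'h; rewrite -(cdv_orthonormal W (interior_lt hk) k'h).
by apply: eq_Rintegral => t; rewrite inE/= in_itv/= => t01; rewrite wavelet_basis.
Qed.

Lemma mean_wavelet2 h k h' k' : interior h k -> interior h' k' ->
  \int[uniform01]_t (wavelet h k t * wavelet h' k' t) =
  ((h == h') && (k == k'))%:R.
Proof.
move=> hk hk'; rewrite -(inner01_wavelet hk (interior_lt hk')).
rewrite -(inner01_mean (g := cdv_basis W h' k')) => [//|||t t01].
- exact: bm_wavelet.
- exact: bm_wavelet.
by rewrite wavelet_basis.
Qed.

End interior_wavelets.

(** * One-level wavelet sums in Besov balls *)

Section ell_norm.
Context {R : realType}.
Implicit Types (p : \bar R) (a : nat -> R).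

Lemma fine_invr r : 1 <= r -> fine (r%:E^-1)%E = r^-1 :> R.
Proof. by move=> r1; rewrite /inve/= gt_eqF// (lt_le_trans ltr01). Qed.

(** Valid for infinite [p] as well, where the exponent [1 / p] is zero. *)
Lemma ell_norm_le p m a A : (1 <= p)%E -> 0 <= A ->
  (forall k, (k < m)%N -> `|a k| <= A) ->
  ell_norm p m a <= m%:R `^ fine p^-1%E * A.
Proof.
move=> p1 A0 aA; case: p p1 => [r r1|_|]; last by rewrite leNgt ltNyr.
  rewrite lee_fin in r1; rewrite fine_invr//.
  have r0 : 0 < r by exact: lt_le_trans r1.
  have -> : m%:R `^ r^-1 * A = (\sum_(k < m) A `^ r) `^ r^-1.
    rewrite sumr_const card_ord -[A `^ r *+ m]mulr_natl powRM ?powR_ge0//.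
    by rewrite -powRrM mulfV ?gt_eqF// powRr1.
  rewrite ge0_ler_powR ?nnegrE ?invr_ge0 ?(ltW r0)//.
  - by apply: sumr_ge0 => k _; exact: powR_ge0.
  - by apply: sumr_ge0 => k _; exact: powR_ge0.
  - apply: ler_sum => k _; rewrite ge0_ler_powR ?nnegrE ?(ltW r0)//.
    exact: aA.
rewrite invey powRr0 mul1r.
by apply: bigmax_le => // k _; exact: aA.
Qed.

Lemma ell_norm0 p m a : (1 <= p)%E -> (forall k, (k < m)%N -> a k = 0) ->
  ell_norm p m a = 0.
Proof.
move=> p1 a0; apply/eqP; rewrite eq_le; apply/andP; split.
  have := @ell_norm_le p m a 0 p1 (lexx _); rewrite mulr0; apply => k /a0 ->.
  by rewrite normr0.
case: p p1 => [r _|_|]/=; first exact: powR_ge0; last by rewrite leNgt ltNyr.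
by apply: bigmax_ge_id.
Qed.

Lemma ell_norm_ge0 p m a : (1 <= p)%E -> 0 <= ell_norm p m a.
Proof.
case: p => [r _|_|]/=; first exact: powR_ge0; last by rewrite leNgt ltNyr.
by apply: bigmax_ge_id.
Qed.

End ell_norm.

Section wavelet_sum.
Context {R : realType} {r : nat} (W : cdv_wavelets R r).
Variables (h : nat) (c : nat -> R).
Hypothesis c_interior : forall k, (k < 2 ^ h)%N -> c k != 0 -> interior W h k.

Definition wavelet_sum (t : R) : R := \sum_(k < 2 ^ h) c k * wavelet W h k t.

Lemma bm_wavelet_sum : bounded_measurable wavelet_sum.
Proof. by apply: bm_sum => k _; exact/bmZ/bm_wavelet. Qed.

Lemma mean_wavelet_sum : \int[uniform01]_t wavelet_sum t = 0.
Proof.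
rewrite mean_sum => [|k _]; last exact/bmZ/bm_wavelet.
rewrite big1// => k _; rewrite meanZ; last exact: bm_wavelet.
have [->|ck] := eqVneq (c k) 0; first by rewrite mul0r.
by rewrite mean_wavelet ?mulr0//; exact: c_interior.
Qed.

Lemma inner01_wavelet_sum (g G : R -> R) : bounded_measurable G ->
  (forall t, 0 <= t <= 1 -> g t = G t) ->
  inner01 wavelet_sum g = \sum_(k < 2 ^ h) c k * inner01 (wavelet W h k) g.
Proof.
move=> bG gG; have bw k := bm_wavelet W h k.
rewrite (inner01_mean bm_wavelet_sum bG gG).
transitivity (\int[uniform01]_t \sum_(k < 2 ^ h) c k * (wavelet W h k t * G t)).
  apply: eq_Rintegral => t _; rewrite mulr_suml; apply: eq_bigr => k _.
  by rewrite mulrA.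
rewrite mean_sum => [|k _]; last exact/bmZ/bmM.
apply: eq_bigr => k _; rewrite meanZ; last exact: bmM.
by rewrite (inner01_mean (bw k) bG gG).
Qed.

Lemma inner01_wavelet_sum_psi0 : inner01 wavelet_sum (cdv_psi0 W) = 0.
Proof.
have [G bG gG] := mra_bounded (cdv_psi0_mra W).
rewrite (inner01_wavelet_sum bG gG) big1// => k _.
have [->|/(c_interior (ltn_ord k)) ik] := eqVneq (c k) 0; first by rewrite mul0r.
rewrite (_ : inner01 _ _ = 0) ?mulr0//.
rewrite -[RHS](cdv_psi0_orth W (interior_lt ik)).
apply: eq_Rintegral => t; rewrite inE/= in_itv/= => t01.
by rewrite wavelet_basis// mulrC.
Qed.

Lemma inner01_wavelet_sum_basis h' k : (k < 2 ^ h')%N ->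
  inner01 wavelet_sum (cdv_basis W h' k) = if h' == h then c k else 0.
Proof.
move=> kh'; have [G bG gG] := mra_bounded (cdv_basis_mra W kh').
rewrite (inner01_wavelet_sum bG gG).
have E (i : 'I_(2 ^ h)) : c i * inner01 (wavelet W h i) (cdv_basis W h' k) =
    c i * ((h == h') && (i == k :> nat))%:R.
  have [->|/(c_interior (ltn_ord i)) ik] := eqVneq (c i) 0; first by rewrite !mul0r.
  by rewrite inner01_wavelet.
under eq_bigr do rewrite E.
rewrite eq_sym; case: eqVneq kh' => [<-|_] kh'; last by apply: big1 => i _; rewrite mulr0.
rewrite (bigD1 (Ordinal kh'))//= eqxx mulr1 big1 ?addr0// => i ik.
by rewrite (_ : (i == k :> nat) = false) ?mulr0//; exact: negbTE.
Qed.

(** Only level [h] contributes, where the [2^h] coefficients are at most [A], which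
    makes the factor [2^(- h / p)] disappear.  The [q]-th power of a number in
    [0, 1] is at most that number, so that a bound by 1 and by the radius serves
    for all [q]. *)
Lemma wavelet_sum_besov (s radius A : R) (p q : \bar R) :
  (1 <= p)%E -> (1 <= q)%E -> 0 <= A -> (forall k, `|c k| <= A) ->
  0 <= radius -> 2 `^ (h%:R * (s + 2^-1)) * A <= Num.min 1 radius ->
  besov_class W s p q radius wavelet_sum.
Proof.
move=> p1 q1 A0 cA rad0; rewrite le_min => /andP[small1 small].
have [ms _] := bm_wavelet_sum.
have level0 h' : h' != h -> besov_level W s p wavelet_sum h' = 0.
  move=> hh'; rewrite /besov_level ell_norm0 ?mulr0// => k kh'.
  by rewrite inner01_wavelet_sum_basis// (negbTE hh').
have level_ge0 h' : 0 <= besov_level W s p wavelet_sum h'.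
  by rewrite mulr_ge0 ?powR_ge0// ell_norm_ge0.
have level_le : besov_level W s p wavelet_sum h <= 2 `^ (h%:R * (s + 2^-1)) * A.
  have -> : 2 `^ (h%:R * (s + 2^-1)) =
      2 `^ (h%:R * (s + 2^-1 - fine p^-1%E)) * 2 `^ (h%:R * fine p^-1%E).
    by rewrite -powRD -?mulrDr ?subrK// pnatr_eq0 implybT.
  rewrite /besov_level -[leRHS]mulrA ler_wpM2l ?powR_ge0//.
  rewrite (powRrM 2) powR_mulrn// -natrX.
  apply: ell_norm_le => // k kh.
  by rewrite inner01_wavelet_sum_basis// eqxx.
split => //.
- by apply: (bounded_integrable01 (f := fun t => wavelet_sum t ^+ 2)); exact/bmX/bm_wavelet_sum.
- exact: inner01_wavelet_sum_psi0.
case: q q1 => [u u1| _ h'|]; last by rewrite leNgt ltNyr.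
  rewrite lee_fin in u1; have u0 : 0 < u by exact: lt_le_trans u1.
  rewrite (nneseriesD1 (n := h))//=; last by move=> k _; rewrite lee_fin powR_ge0.
  rewrite eseries0 => [|k _ kh]; last by rewrite level0// powR0 ?gt_eqF.
  have l1 := le_trans level_le small1.
  rewrite adde0 lee_fin; apply: le_trans small; apply: le_trans level_le.
  have [->|l0] := eqVneq (besov_level W s p wavelet_sum h) 0; first by rewrite powR0 ?gt_eqF.
  by rewrite ge1r_powR// l1 andbT lt_neqAle eq_sym l0 level_ge0.
have [->|hh'] := eqVneq h' h; first exact: le_trans level_le small.
by rewrite level0.
Qed.

End wavelet_sum.

(** * Additive logits built from wavelets of the features *)

Lemma bm_Lfun1 d (T : measurableType d) (R : realType) (P : probability T R)
    (f : T -> R) : bounded_measurable f -> f \in Lfun P 1%E.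
Proof. by move=> bf; apply/Lfun1_integrable; exact: bm_integrable. Qed.

Lemma bm_Lfun2 d (T : measurableType d) (R : realType) (P : probability T R)
    (f : T -> R) : bounded_measurable f -> f \in Lfun P 2%:E.
Proof.
move=> bf; rewrite inE; apply/andP; split; rewrite inE/=; first by case: bf.
rewrite /finite_norm unlock poweR_lty//.
have E x : (`|(EFin \o f) x| `^ 2)%E = (f x ^+ 2)%:E.
  rewrite -[LHS]/((`|f x|)%:E `^ 2)%E poweR_EFin powR_mulrn//.
  by rewrite real_normK ?num_real.
under eq_integral do rewrite E.
by rewrite EFin_Rintegral ?ltry//; exact: bmX.
Qed.

Section design.
Context {R : realType} {r : nat} (W : cdv_wavelets R r) (d : nat).

Definition wavelet_feature (h k : nat) (j : 'I_d) (x : d.-tuple R) : R :=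
  wavelet W h k (tnth x j).

Lemma bm_wavelet_feature h k j : bounded_measurable (wavelet_feature h k j).
Proof. exact/bm_tnth/bm_wavelet. Qed.

HB.instance Definition _ h k j :=
  isMeasurableFun.Build _ _ _ _ (wavelet_feature h k j)
    (proj1 (bm_wavelet_feature h k j)).

Context {d0 : nat} (s : 'I_d0 -> R) (p q : 'I_d0 -> \bar R) (radius : 'I_d0 -> R).
Context {I : finType} {L : nat}.
(** Coordinate [i] with index [l] acts on the feature [feat i l].  The resolution
    is a function of the feature, so that the component of each feature lives at
    one level. *)
Variables (feat : I -> 'I_L -> 'I_d) (level : 'I_d -> nat) (pos : I -> nat).
Variables (rank : 'I_d -> 'I_d0) (n : nat) (b : I -> d.-tuple R -> R) (beta K : R).

Definition design_psi i l : {mfun (d.-tuple R) >-> R} :=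
  wavelet_feature (level (feat i l)) (pos i) (feat i l).

Notation PX := (iid_law (@uniform01 R) d).
Notation logit := (random_logit design_psi beta).

Hypotheses (p_ge1 : forall j, (1 <= p j)%E) (q_ge1 : forall j, (1 <= q j)%E).
Hypothesis radius_ge0 : forall j, 0 <= radius j.
Hypotheses (beta_gt0 : 0 < beta) (L_gt0 : (0 < L)%N) (I_gt0 : (0 < #|I|)%N).
Hypothesis feat_interior : forall i l, interior W (level (feat i l)) (pos i).
Hypothesis feat_inj : forall i l j m,
  feat i l = feat j m -> pos i = pos j -> (i, l) = (j, m).
(** A configuration uses one index [l] for each [i]: ranks have to separate the
    features that occur together in a configuration, not the others. *)
Hypothesis rank_inj : forall i l j m,
  rank (feat i l) = rank (feat j m) -> (i = j -> l = m) -> feat i l = feat j m.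
Hypothesis besov_small : forall i l,
  2 `^ ((level (feat i l))%:R * (s (rank (feat i l)) + 2^-1)) * beta <=
  Num.min 1 (radius (rank (feat i l))).

Lemma design_orthonormal i l j m :
  \int[PX]_x (design_psi i l x * design_psi j m x) = ((i == j) && (l == m))%:R.
Proof.
have bw h k := bm_wavelet W h k.
have [ff|ff] := eqVneq (feat i l) (feat j m); last first.
  rewrite (mean_tnth2 uniform01 ff (bw (level (feat i l)) (pos i))
    (bw (level (feat j m)) (pos j))).
  rewrite (mean_wavelet (feat_interior i l)) mul0r.
  case: eqP => //= ij; case: eqP => //= lm.
  by move: ff; rewrite ij lm eqxx.
transitivity (\int[PX]_x (fun t => wavelet W (level (feat i l)) (pos i) t *
    wavelet W (level (feat i l)) (pos j) t) (tnth x (feat i l))).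
  by apply: eq_Rintegral => x _; rewrite /design_psi/= /wavelet_feature -ff.
rewrite (mean_tnth _ _ (bmM (bw _ _) (bw _ _))) mean_wavelet2//; last first.
  by rewrite ff.
rewrite eqxx/=; congr (nat_of_bool _)%:R.
apply/eqP/andP => [/(feat_inj ff)[-> ->]|[/eqP -> //]].
by rewrite !eqxx.
Qed.

(** Grouping the active indices by feature gives the additive decomposition:
    one wavelet sum for each active feature. *)
Lemma design_additive (th : {ffun I -> activation L}) :
  additive_class W s p q radius PX (logit th).
Proof.
pose f i := feat i (th i).1.2.
pose J := [set f i | i : I & (th i).1.1]%SET.
have f_rank : {in J &, injective rank}.
  move=> _ _ /imsetP[i _ ->] /imsetP[j _ ->] /rank_inj; apply => ->.
  by [].
pose c (j : 'I_d) (k : nat) : R :=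
  \sum_(i | [&& f i == j, pos i == k & (th i).1.1]) beta * sign_of (th i).
have c_le j k : `|c j k| <= beta.
  rewrite /c; have [i /and3P[/eqP fi /eqP pi ai]|none] := pickP (fun i =>
      [&& f i == j, pos i == k & (th i).1.1]); last first.
    by rewrite big_pred0// normr0 ltW.
  rewrite (big_pred1 i) => [|i'].
    by rewrite normrM gtr0_norm// ler_piMr ?(ltW beta_gt0)// normr_sign_of.
  apply/and3P/eqP => [[/eqP fi' /eqP pi' _]|->]; last by rewrite fi pi.
  by have [] := feat_inj (etrans fi' (esym fi)) (etrans pi' (esym pi)).
have c_interior j k : c j k != 0 -> interior W (level j) k.
  rewrite /c; have [i /and3P[/eqP <- /eqP <- _] _|none] := pickP (fun i =>
      [&& f i == j, pos i == k & (th i).1.1]); first exact: feat_interior.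
  by rewrite big_pred0// eqxx.
pose gj j := wavelet_sum W (level j) (c j).
have bgj j := bm_wavelet_sum W (level j) (c j).
have bg : bounded_measurable (logit th).
  by apply/bmZ/bm_sum => i _; exact/bmZ/bm_wavelet_feature.
split; first exact: bm_Lfun2.
exists 0, J, rank, gj; split.
- by rewrite -(card_in_imset f_rank) -[leqRHS]card_ord max_card.
- exact: f_rank.
- move=> _ /imsetP[i _ ->]; apply: (wavelet_sum_besov _ _ _ (ltW beta_gt0)) => //.
    by move=> k _; exact: c_interior.
  exact: besov_small.
- move=> j _; have bt := bm_tnth j (bgj j); split; first exact: bm_Lfun1.
  rewrite unlock EFin_Rintegral//.
  rewrite (mean_tnth _ _ (bgj j)) mean_wavelet_sum// => k _.
  exact: c_interior.
move=> x; rewrite add0r /random_logit mulr_sumr.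
rewrite (bigID (fun i => (th i).1.1))/= [X in _ + X]big1 ?addr0; last first.
  by move=> i /negbTE ai; rewrite /sign_of ai mul0r mulr0.
rewrite (partition_big f (mem J)) => [|i ai]; last first.
  by apply: imset_f; rewrite inE.
apply: eq_bigr => j _; rewrite /gj /wavelet_sum.
have pos_lt i : (th i).1.1 && (f i == j) -> (pos i < 2 ^ level j)%N.
  by move=> /andP[_ /eqP <-]; exact: interior_lt (feat_interior _ _).
rewrite [RHS](eq_bigr (fun k : 'I_(2 ^ level j) => \sum_(i | [&& f i == j, pos i == k
  & (th i).1.1]) beta * sign_of (th i) * wavelet W (level j) k (tnth x j))); last first.
  by move=> k _; rewrite /c mulr_suml.
rewrite (exchange_big_dep (fun i => (th i).1.1 && (f i == j)))/=; last first.
  by move=> k i _ /and3P[-> _ ->].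
apply: eq_bigr => i fi; rewrite (big_pred1 (Ordinal (pos_lt i fi))).
  rewrite /design_psi/= /wavelet_feature mulrA.
  by have /andP[_ /eqP <-] := fi.
move=> k /=; have /andP[-> ->] := fi; rewrite /= andbT.
by apply/eqP/eqP => [kp|->//]; exact: val_inj.
Qed.

Hypothesis psi_le : forall i l x, `|design_psi i l x| <= b i x.
Hypothesis b_le : forall i x, beta * b i x <= 1.
Hypothesis sum_b : forall x, \sum_i b i x ^+ 2 <= K * #|I|%:R.

(** The bound holds for every classifier, since the configuration may depend on
    it. *)
Theorem design_minimax : 1 <= K ->
  (1 + beta ^+ 2) ^+ n - 1 <= L%:R / (128 * K ^+ 2) ->
  Num.sqrt (#|I|%:R * beta ^+ 2) <= (64 * K)^-1 ->
  ((Num.sqrt (#|I|%:R * beta ^+ 2) / (64 * K))%:E <=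
    minimax_excess_risk W n d s p q radius)%E.
Proof.
move=> K1 info small; apply: le_ereal_inf_tmp => _ [eta _ <-].
have [th risk_ge] := random_logit_excess beta_gt0 L_gt0 I_gt0 psi_le b_le sum_b
  design_orthonormal (measurable_funPT eta) K1 info small.
apply: (@le_trans _ _ (excess_risk (labelled_law PX (logit th)) (logit th) eta)).
  by rewrite excess_riskE lee_fin.
apply: ereal_sup_ubound; exists PX, (logit th), (labelled_law PX (logit th)); split => //.
- exact: feature_law_uniform.
- exact: design_additive.
exists (fun x => sigmoid (logit th x)); split.
- exact: (bm_sigmoid (logit th)).1.
- by move=> x; rewrite sigmoid_gt0 sigmoid_lt1.
- by move=> x; rewrite ln_odds_sigmoid.
- by move=> A C mA; exact: labelled_law_rectangle.
Qed.

End design.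

(** * Choice of the design *)

Section calibration.
Context {R : realType}.

(** With [x = ln (e L)], [(1 + beta^2)^n] is at most [exp (kappa^2 x)], and
    [exp y - 1 <= y exp y] is at most [2 kappa^2 e L] when [y = kappa^2 x <= x / 2],
    because [x / 2 <= exp (x / 2)].  In particular it is small when [L = 1] too. *)
Lemma information_small (n L : nat) (kappa beta K : R) :
  (0 < n)%N -> (0 < L)%N -> 0 < K -> 0 < kappa -> 32 * K * kappa <= 1 ->
  K >= 1 -> n%:R * beta ^+ 2 = kappa ^+ 2 * ln (expR 1 * L%:R) ->
  (1 + beta ^+ 2) ^+ n - 1 <= L%:R / (128 * K ^+ 2).
Proof.
move=> n0 L0 K0 k0 kK K1 nb; set x := ln _ in nb.
have L1 : 1 <= L%:R :> R by rewrite ler1n.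
have eL : expR x = expR 1 * L%:R by rewrite lnK// posrE mulr_gt0 ?expR_gt0// ltr0n.
have x0 : 0 <= x.
  by rewrite ln_ge0//; have := expR_ge1Dx (1 : R); nra.
have k1 : kappa <= 32^-1 by nra.
have y_le : kappa ^+ 2 * x <= x / 2 by rewrite mulrC ler_wpM2l//; nra.
set y := kappa ^+ 2 * x in nb y_le.
have y0 : 0 <= y by rewrite mulr_ge0// sqr_ge0.
have step1 : (1 + beta ^+ 2) ^+ n <= expR y.
  rewrite -nb mulrC expRM_natr lerXn2r ?nnegrE ?expR_ge0 ?addr_ge0 ?sqr_ge0//.
  exact: expR_ge1Dx.
have step2 : expR y - 1 <= y * expR y.
  have := expR_ge1Dx (- y); rewrite expRN => h.
  have e0 := expR_gt0 y; have := ler_wpM2r (ltW e0) h.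
  by rewrite mulVf ?gt_eqF//; lra.
have step3 : y * expR y <= 2 * kappa ^+ 2 * expR x.
  have h1 : expR y <= expR (x / 2) by rewrite ler_expR.
  have h2 : x / 2 <= expR (x / 2) by have := expR_ge1Dx (x / 2); lra.
  have h3 : expR x = expR (x / 2) * expR (x / 2).
    by rewrite -expRD; congr expR; field.
  have e0 := expR_gt0 (x / 2).
  apply: (@le_trans _ _ (y * expR (x / 2))); first by rewrite ler_wpM2l.
  rewrite /y h3 (_ : 2 * kappa ^+ 2 * _ = kappa ^+ 2 * ((2 * expR (x / 2)) * expR (x / 2))); last by ring.
  rewrite -mulrA ler_wpM2l ?sqr_ge0// ler_wpM2r ?(ltW e0)//; lra.
have step4 : 2 * kappa ^+ 2 * expR x <= L%:R / (128 * K ^+ 2).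
  rewrite eL ler_pdivlMr ?mulr_gt0 ?exprn_gt0//.
  have e4 : expR 1 <= 4 :> R.
    have := expR_ge1Dx (- (2^-1 : R)); rewrite expRN => h.
    have e0 := expR_gt0 (2^-1 : R).
    have h2 : expR (2^-1) <= 2 :> R.
      have := ler_wpM2r (ltW e0) h; rewrite mulVf ?gt_eqF//; lra.
    have -> : expR 1 = expR (2^-1) * expR (2^-1) :> R by rewrite -expRD; congr expR; lra.
    nra.
  have kk : (32 * K * kappa) ^+ 2 <= 1 by rewrite expr_le1// !mulr_ge0 ?ltW.
  have -> : 2 * kappa ^+ 2 * (expR 1 * L%:R) * (128 * K ^+ 2) =
     (32 * K * kappa) ^+ 2 * (expR 1 / 4) * L%:R by field.
  have : (32 * K * kappa) ^+ 2 * (expR 1 / 4) <= 1 * 1.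
    by rewrite ler_pM ?sqr_ge0 ?divr_ge0 ?expR_ge0//; lra.
  by rewrite mulr1 => h; rewrite -[leRHS]mul1r ler_wpM2r.
lra.
Qed.

(** The level [h1] is coarse enough to be fixed and fine enough to have interior
    wavelets; below it the resolution is rounded up, at the cost of a constant
    factor. *)
Definition resolution (h1 : nat) (v : R) : nat :=
  maxn h1 (trunc_log 2 (Num.truncn v)).

Lemma resolution_bounds h1 v : 1 <= v ->
  [/\ (h1 <= resolution h1 v)%N,
      resolution h1 v = h1 \/ 2 ^+ resolution h1 v <= v,
      v <= 2 * 2 ^+ resolution h1 v &
      2 ^+ resolution h1 v <= 2 ^+ h1 * v].
Proof.
move=> v1; set t := trunc_log 2 (Num.truncn v).
have v0 : 0 <= v by lra.
have n0 : (0 < Num.truncn v)%N by rewrite truncn_gt0.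
have tv : 2 ^+ t <= v.
  apply: (@le_trans _ _ (Num.truncn v)%:R); last by rewrite truncn_le.
  by rewrite -natrX ler_nat trunc_logP.
have vt : v <= 2 * 2 ^+ t.
  apply: (@le_trans _ _ (Num.truncn v).+1%:R); first exact/ltW/truncnS_gt.
  by rewrite -exprS -natrX ler_nat trunc_log_ltn.
have p1 : 1 <= 2 ^+ h1 :> R by rewrite exprn_ege1// ler1n.
rewrite /resolution -/t; have [th|ht] := leqP t h1.
- have tth : 2 ^+ t <= 2 ^+ h1 :> R by rewrite ler_weXn2l// ler1n.
  by split => //; [left | apply: le_trans vt _; rewrite ler_pM2l | nra].
- by split; [exact: ltnW | right | by [] | nra].
Qed.

End calibration.

(** * The two lower bounds *)

Lemma leq_double_of_gap (P m X : nat) :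
  (2 * X <= P)%N -> (P <= X + m)%N -> (P <= 2 * m)%N.
Proof. by lia. Qed.

Lemma support_gap (N a a' : nat) : (a < a')%N ->
  (N + N.*2 * a + N + N < N + N.*2 * a' + 1)%N.
Proof.
move=> aa'; have : (N.*2 * a.+1 <= N.*2 * a')%N by rewrite leq_mul2l aa' orbT.
by rewrite mulnS; lia.
Qed.

Section lower_bounds.
Context {R : realType} {r : nat} (W : cdv_wavelets R r).
Let N := cdv_size W.
Let h1 := (cdv_coarse W).+1.

Lemma cdv_size_gt0 : (0 < N)%N.
Proof. exact: scaling_size_gt0 (cdv_mother_wavelet W). Qed.

Lemma mother_bounded : exists2 M : R, 1 <= M & forall t, `|cdv_mother W t| <= M.
Proof.
have [_ [M HM]] := bm_mother W; exists (1 + `|M|); first by rewrite lerDl.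
by move=> t; rewrite (le_trans (HM t))// (le_trans (ler_norm M))// lerDr.
Qed.

Variables (M kappa rho B : R).
Hypotheses (M_ge1 : 1 <= M) (mother_le : forall t, `|cdv_mother W t| <= M).
(** [M^2 2^h1] bounds the squares of the wavelets of level [h1]; the
    factor [4 N] comes from keeping one wavelet out of [2 N] at each level
    ([size_large]). *)
Let K : R := 4 * N%:R * M ^+ 2 * 2 ^+ h1.
Hypothesis kappa_gt0 : 0 < kappa.
Hypothesis kappa_K : 64 * K * kappa <= 1.
Hypothesis kappa_B : 64 * K * kappa * (1 + 2 ^+ h1 * `|B|) <= 1.
Hypothesis kappa_rho : 2 `^ (h1%:R * (r%:R + 1)) * kappa <= Num.min 1 rho.

Let N1 : 1 <= N%:R :> R. Proof. by rewrite ler1n cdv_size_gt0. Qed.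

Let p1 : 1 <= 2 ^+ h1 :> R. Proof. by rewrite exprn_ege1// ler1n. Qed.

Let K_ge : M ^+ 2 * 2 ^+ h1 <= K.
Proof.
rewrite (_ : K = (4 * N%:R) * (M ^+ 2 * 2 ^+ h1)); last by rewrite /K; ring.
by rewrite ler_peMl//; [rewrite mulr_ge0 ?sqr_ge0// (le_trans ler01)|have := N1; lra].
Qed.

Let K_ge4 : 4 * N%:R * M ^+ 2 <= K.
Proof. by rewrite /K ler_peMr// !mulr_ge0// ?sqr_ge0// (le_trans ler01). Qed.

Let K1 : 1 <= K.
Proof.
have := p1; set a := 2 ^+ h1 => a1; apply: le_trans K_ge; rewrite -/a.
have m1 : 1 <= M ^+ 2 by rewrite exprn_ege1.
nra.
Qed.

Let kappa_le1 : kappa <= 1. Proof. by move: K1 kappa_K; move: (K) => k k1 kk; nra. Qed.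

Let kappa_inv : kappa <= (64 * K)^-1.
Proof.
have k0 : 0 < 64 * K by rewrite mulr_gt0// (lt_le_trans ltr01 K1).
by rewrite -div1r (ler_pdivlMr _ _ k0) mulrC.
Qed.

Let kappa_K1 : kappa * K <= 1.
Proof.
have kK0 : 0 <= K * kappa by rewrite mulr_ge0 ?(ltW kappa_gt0)// (le_trans ler01 K1).
by apply: le_trans kappa_K; rewrite -mulrA (mulrC kappa); lra.
Qed.

Lemma wavelet_le h k t : `|wavelet W h k t| <= Num.sqrt (2 ^+ h) * M.
Proof.
by rewrite /wavelet /dilate normrM (ger0_norm (sqrtr_ge0 _)) ler_wpM2l ?sqrtr_ge0.
Qed.

Let wavelet_sqr_le h k t : wavelet W h k t ^+ 2 <= 2 ^+ h * M ^+ 2.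
Proof.
rewrite -(sqr_sqrtr (exprn_ge0 h (ler0n R 2))) -exprMn -real_normK ?num_real//.
by rewrite lerXn2r ?nnegrE ?wavelet_le// mulr_ge0 ?sqrtr_ge0// (le_trans ler01).
Qed.

Let coarse_interior : interior W h1 N.
Proof.
have := cdv_coarse_large W; rewrite -/N /interior -/N /h1 => NJ.
apply/and3P; split=> //; rewrite addnn (leq_ltn_trans NJ)//.
by rewrite ltn_exp2l.
Qed.

Section bounds.
Variables (n d d0 : nat) (s : 'I_d0 -> R) (p q : 'I_d0 -> \bar R) (radius : 'I_d0 -> R).
Hypotheses (d0_gt0 : (0 < d0)%N) (d0_le : (d0 <= d)%N) (n_gt0 : (0 < n)%N).
Hypotheses (p_ge1 : forall j, (1 <= p j)%E) (q_ge1 : forall j, (1 <= q j)%E).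
Hypothesis s_range : forall j, 0 < s j < r%:R.
Hypothesis rho_le : forall j, rho <= radius j.
Hypothesis rho_gt0 : 0 < rho.

Let n0 : 0 < n%:R :> R. Proof. by rewrite ltr0n. Qed.

Let radius_ge0 j : 0 <= radius j.
Proof. exact: le_trans (ltW rho_gt0) (rho_le j). Qed.

Let min_rho j : Num.min 1 rho <= Num.min 1 (radius j).
Proof. by rewrite le_min ge_min lexx/= ge_min rho_le orbT. Qed.

Let coarse_besov j beta : 0 <= beta -> beta <= kappa ->
  2 `^ (h1%:R * (s j + 2^-1)) * beta <= Num.min 1 (radius j).
Proof.
move=> b0 bk; apply: le_trans (min_rho j); apply: le_trans kappa_rho.
rewrite ler_pM ?powR_ge0// ler_powR ?ler1n// ler_wpM2l//.
by have /andP[_ sr] := s_range j; lra.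
Qed.

Section sparse.
Let L := (d %/ d0)%N.
Let beta := kappa * Num.sqrt (ln (expR 1 * L%:R) / n%:R).
Hypothesis info : d0%:R * ln (expR 1 * L%:R) <= n%:R :> R.

Let L0 : (0 < L)%N. Proof. by rewrite divn_gt0. Qed.

(** Feature number [i * L + l] is the [l]-th of block [i]. *)
Let feat_lt (i : 'I_d0) (l : 'I_L) : (i * L + l < d)%N.
Proof.
apply: (@leq_trans (d0 * L)); last by rewrite mulnC leq_divM.
by rewrite (@leq_trans (i.+1 * L))// ?leq_mul2r ?ltn_ord ?orbT// mulSn addnC ltn_add2r.
Qed.

Let feat i l : 'I_d := Ordinal (feat_lt i l).
Let rank (j : 'I_d) : 'I_d0 := insubd (Ordinal d0_gt0) (j %/ L)%N.

Let rank_feat i l : rank (feat i l) = i.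
Proof.
by apply: val_inj; rewrite val_insubd/= divnMDl// divn_small// addn0 ltn_ord.
Qed.

Let lnL : 1 <= ln (expR 1 * L%:R) :> R.
Proof.
rewrite lnM ?posrE ?expR_gt0 ?ltr0n// expRK lerDl ln_ge0//.
by rewrite ler1n.
Qed.

Let beta_gt0 : 0 < beta.
Proof. by rewrite mulr_gt0// sqrtr_gt0 divr_gt0// (lt_le_trans ltr01). Qed.

Let beta2 : beta ^+ 2 = kappa ^+ 2 * (ln (expR 1 * L%:R) / n%:R).
Proof. by rewrite exprMn sqr_sqrtr// divr_ge0// (le_trans ler01). Qed.

Let beta_le : beta <= kappa.
Proof.
rewrite -[leRHS]mulr1 ler_wpM2l ?(ltW kappa_gt0)//.
rewrite -[leRHS]sqrtr1 ler_sqrt// ler_pdivrMr// mul1r (le_trans _ info)//.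
by rewrite ler_peMl ?ler1n// (le_trans ler01).
Qed.

(** A single level and a single translation: distinct coordinates act on distinct
    features. *)
Lemma sparse_minimax :
  ((Num.sqrt (d0%:R * beta ^+ 2) / (64 * K))%:E <=
    minimax_excess_risk W n d s p q radius)%E.
Proof.
have kK : 32 * K * kappa <= 1.
  by move: K1 kappa_K; move: (K) => k k1 kk; nra.
rewrite -{1}(card_ord d0).
apply: (@design_minimax _ _ W d d0 s p q radius 'I_d0 L feat (fun=> h1) (fun=> N)
   rank n (fun _ _ => Num.sqrt (2 ^+ h1) * M) beta K) => //.
- by rewrite card_ord.
- move=> i l j m fe _; have ij : i = j by rewrite -(rank_feat i l) fe rank_feat.
  rewrite -ij in fe *; congr pair; apply: val_inj.
  by have /eqP := congr1 val fe; rewrite /= eqn_add2l => /eqP.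
- by move=> i l j m; rewrite !rank_feat => -> /(_ erefl) ->.
- by move=> i l; exact: coarse_besov (ltW beta_gt0) beta_le.
- by move=> i l x; exact: wavelet_le.
- move=> i _.
  have a1 : 1 <= Num.sqrt (2 ^+ h1) :> R.
    by rewrite -[leLHS]sqrtr1 ler_sqrt ?p1// exprn_gt0.
  have a2 : Num.sqrt (2 ^+ h1) ^+ 2 = 2 ^+ h1 :> R by rewrite sqr_sqrtr ?exprn_ge0.
  have kb : kappa * (M ^+ 2 * 2 ^+ h1) <= 1.
    by apply: le_trans kappa_K1; rewrite ler_wpM2l ?(ltW kappa_gt0).
  move: a1 a2 kb; set a := Num.sqrt _ => a1 <- kb.
  apply: (@le_trans _ _ (kappa * (M ^+ 2 * a ^+ 2))) => //.
  have aM : a * M <= M ^+ 2 * a ^+ 2.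
    have aM1 : 1 <= a * M by rewrite mulr_ege1.
    rewrite (_ : M ^+ 2 * a ^+ 2 = (a * M) * (a * M)); last by ring.
    by rewrite ler_peMr// (le_trans ler01).
  by rewrite ler_pM ?(ltW beta_gt0)// mulr_ge0 ?sqrtr_ge0// (le_trans ler01).
- move=> x; rewrite sumr_const card_ord -[leLHS]mulr_natr ler_wpM2r//.
  by rewrite exprMn sqr_sqrtr ?exprn_ge0// mulrC.
- apply: (@information_small _ n L kappa) => //; first exact: lt_le_trans K1.
  by rewrite beta2; field; rewrite gt_eqF.
- rewrite card_ord -[leRHS]ger0_norm ?(le_trans (ltW kappa_gt0) kappa_inv)//.
  rewrite -sqrtr_sqr ler_sqrt ?sqr_ge0//.
  apply: (@le_trans _ _ (kappa ^+ 2)).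
    rewrite beta2 mulrCA -[leRHS]mulr1 ler_wpM2l ?sqr_ge0// mulrA.
    by rewrite ler_pdivrMr// mul1r.
  by rewrite lerXn2r ?nnegrE ?(ltW kappa_gt0)// (le_trans (ltW kappa_gt0)).
Qed.

End sparse.

Section smooth.
Let v (j : 'I_d0) : R := n%:R `^ (2 * s j + 1)^-1.

Variable lev : 'I_d0 -> nat.
Hypothesis lev_ge : forall j, (h1 <= lev j)%N.
Hypothesis lev_coarse_or : forall j, lev j = h1 \/ 2 ^+ lev j <= v j.
Hypothesis v_le_lev : forall j, v j <= 2 * 2 ^+ lev j.
Hypothesis lev_le_v : forall j, 2 ^+ lev j <= 2 ^+ h1 * v j.

(** The supports of the wavelets have length [2 N - 1] in units of [2^-h], and the
    translations kept are [N + 2 N a], for [a] less than [block_size j]. *)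
Definition block_size j := ((2 ^ lev j).-1 %/ N.*2)%N.

Let beta := kappa / Num.sqrt n%:R.
Let I := {j : 'I_d0 & 'I_(block_size j)}.
Let rank (j : 'I_d) : 'I_d0 := insubd (Ordinal d0_gt0) (val j).
Let feat (i : I) (_ : 'I_1) : 'I_d := widen_ord d0_le (tag i).
Let level j := lev (rank j).
Let pos (i : I) := (N + N.*2 * tagged i)%N.

Let s_gt0 j : 0 < s j. Proof. by have /andP[] := s_range j. Qed.

Let v_ge1 j : 1 <= v j.
Proof.
rewrite -[leLHS](powRr0 n%:R) ler_powR ?ler1n// invr_ge0.
by rewrite addr_ge0// mulr_ge0// ltW.
Qed.

Let v_len j : v j <= n%:R.
Proof.
rewrite -[leRHS](powRr1 (ltW n0)) ler_powR ?ler1n// invf_le1.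
  by rewrite lerDr mulr_ge0// ltW.
by rewrite ltr_wpDl// mulr_ge0// ltW.
Qed.

Let v_rate j : v j / n%:R = n%:R `^ (- (2 * s j / (2 * s j + 1))).
Proof.
have sj := s_gt0 j; have nn : n%:R != 0 :> R by rewrite gt_eqF.
rewrite -[in X in _ / X](powRr1 (ltW n0)) -powRN -powRD ?nn ?implybT//.
by congr powR; field; lra.
Qed.

Let rank_feat i l : rank (feat i l) = tag i.
Proof. by apply: val_inj; rewrite val_insubd/= ltn_ord. Qed.

Let level_feat i l : level (feat i l) = lev (tag i).
Proof. by rewrite /level rank_feat. Qed.

Let size_large j : (2 ^ lev j <= 4 * N * block_size j)%N.
Proof.
have N2 : (0 < N.*2)%N by rewrite double_gt0 cdv_size_gt0.
have big : (2 * N.*2 <= 2 ^ lev j)%N.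
  apply: (@leq_trans (2 ^ h1)); last by rewrite leq_exp2l// lev_ge.
  by rewrite expnS leq_mul2l/= cdv_coarse_large.
have pos2 : (0 < 2 ^ lev j)%N by rewrite expn_gt0.
have := ltn_ceil (2 ^ lev j).-1 N2; rewrite -/(block_size j) (prednK pos2) mulSn.
have -> : (4 * N * block_size j = 2 * (block_size j * N.*2))%N.
  by rewrite -mul2n; ring.
exact: leq_double_of_gap.
Qed.

Let size_small j : (block_size j * N.*2 < 2 ^ lev j)%N.
Proof.
have pos2 : (0 < 2 ^ lev j)%N by rewrite expn_gt0.
by rewrite -[X in (_ < X)%N](prednK pos2) ltnS leq_divM.
Qed.

Let size_le_v j : (block_size j)%:R <= 2 ^+ h1 * v j.
Proof.
apply: le_trans (lev_le_v j); rewrite -natrX ler_nat.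
apply: leq_trans (ltnW (size_small j)); apply: leq_pmulr.
by rewrite double_gt0 cdv_size_gt0.
Qed.

Let v_le_size j : v j <= 8 * N%:R * (block_size j)%:R.
Proof.
apply: (le_trans (v_le_lev j)).
rewrite (_ : 8 * N%:R * _ = 2 * (4 * N * block_size j)%:R); last first.
  by rewrite 2!natrM; ring.
by rewrite ler_wpM2l// -natrX ler_nat.
Qed.

Let card_I : #|{: I}| = (\sum_j block_size j)%N.
Proof.
rewrite -sum1_card -(sig_big_dep xpredT (fun _ => xpredT) (fun _ _ => 1%N))/=.
by apply: eq_bigr => j _; rewrite sum1_card card_ord.
Qed.

Let sqrtn : Num.sqrt n%:R ^+ 2 = n%:R :> R.
Proof. by rewrite sqr_sqrtr// ltW. Qed.

Let sqrtn_ge1 : 1 <= Num.sqrt n%:R :> R.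
Proof. by rewrite -[leLHS]sqrtr1 ler_sqrt// ler1n. Qed.

Let beta_gt0 : 0 < beta.
Proof. by rewrite divr_gt0// sqrtr_gt0. Qed.

Let beta2 : beta ^+ 2 = kappa ^+ 2 / n%:R.
Proof. by rewrite expr_div_n sqrtn. Qed.

Let beta_le : beta <= kappa.
Proof.
rewrite ler_pdivrMr ?(lt_le_trans ltr01)// ler_peMr// ltW//.
Qed.

Let pos_interior i : interior W (lev (tag i)) (pos i).
Proof.
case: i => j a; rewrite /pos/=.
apply/and3P; split; [exact: ltnW (lev_ge j)|exact: leq_addr|].
apply: leq_ltn_trans (size_small j); rewrite -/N.
have : (a.+1 * N.*2 <= block_size j * N.*2)%N by rewrite leq_mul2r ltn_ord orbT.
by rewrite mulSn (mulnC _ N.*2) addnAC addnn.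
Qed.

(** At the resolution [n^(1/(2s+1))] the smoothness weight [2^(h (s + 1/2))] is at
    most [sqrt n], the inverse of the order of [beta]. *)
Let level_besov j :
  2 `^ ((lev j)%:R * (s j + 2^-1)) * beta <= Num.min 1 (radius j).
Proof.
have [->|le_v] := lev_coarse_or j.
  exact: coarse_besov (ltW beta_gt0) beta_le.
have sj := s_gt0 j.
apply: (@le_trans _ _ kappa); last first.
  apply: le_trans (min_rho j); apply: le_trans kappa_rho.
  by rewrite ler_peMl ?(ltW kappa_gt0)// -[leLHS](powRr0 2) ler_powR ?ler1n.
rewrite mulrA ler_pdivrMr ?(lt_le_trans ltr01)// mulrC ler_wpM2l ?(ltW kappa_gt0)//.
rewrite powRrM powR_mulrn// -powR12_sqrt ?(ltW n0)//.
apply: (@le_trans _ _ (v j `^ (s j + 2^-1))).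
  by rewrite ge0_ler_powR ?nnegrE ?exprn_ge0 ?(le_trans ler01 (v_ge1 j))//; lra.
rewrite /v -powRrM le_eqVlt; apply/orP; left; apply/eqP; congr powR.
by field; lra.
Qed.

Let disjoint_supports h t (a a' : nat) : a != a' ->
  wavelet W h (N + N.*2 * a) t = 0 \/ wavelet W h (N + N.*2 * a') t = 0.
Proof.
wlog lt : a a' / (a < a')%N.
  move=> H aa'; have [lt|lt|e] := ltngtP a a'.
  - exact: H.
  - by rewrite eq_sym in aa'; have [] := H _ _ lt aa'; [right|left].
  - by rewrite e eqxx in aa'.
move=> _; have msup := @mother_support _ _ W; rewrite -/N in msup.
have [lt_t|t_le] := ltP ((N + N.*2 * a)%:R + N%:R) (2 ^+ h * t).
  by left; apply: (dilate_support msup); right.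
right; apply: (dilate_support msup); left; apply: (le_lt_trans t_le).
have := support_gap N lt.
by rewrite -(ltr_nat R) !natrD; lra.
Qed.

Let sum_at_most_one m (F : 'I_m -> R) c : 0 <= c -> (forall a, F a <= c) ->
  (forall a a', a != a' -> F a = 0 \/ F a' = 0) -> \sum_a F a <= c.
Proof.
move=> c0 Fc F0; have [a Fa|Fz] := pickP (fun a => F a != 0); last first.
  by rewrite big1// => a _; apply/eqP; move: (Fz a) => /negbFE.
rewrite (bigD1 a)//= big1 ?addr0// => a' aa'.
by have [//|Fa0] := F0 _ _ aa'; rewrite Fa0 eqxx in Fa.
Qed.

(** At each [x] and for each feature at most one of the wavelets is nonzero, with
    square at most [M^2 2^h], which is of the order of [block_size]. *)
Lemma smooth_minimax :
  \sum_(j < d0) n%:R `^ (- (2 * s j / (2 * s j + 1))) <= B ->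
  ((Num.sqrt ((\sum_j block_size j)%N%:R * beta ^+ 2) / (64 * K))%:E <=
    minimax_excess_risk W n d s p q radius)%E.
Proof.
move=> rate_le; have kK : 32 * K * kappa <= 1.
  by move: K1 kappa_K; move: (K) => k k1 kk; nra.
rewrite -card_I.
have I_gt0 : (0 < #|{: I}|)%N.
  rewrite card_I (bigD1 (Ordinal d0_gt0))//= addn_gt0; apply/orP; left.
  by have := size_large (Ordinal d0_gt0); case: (block_size _) => //; rewrite muln0 leqn0 expn_eq0.
apply: (@design_minimax _ _ W d d0 s p q radius {: I} 1 feat level pos rank n
   (fun i x => `|design_psi W feat level pos i ord0 x|) beta K) => //.
- by move=> i l; rewrite level_feat; exact: pos_interior.
- move=> i l j m fe; have tij : tag i = tag j by rewrite -(rank_feat i l) fe rank_feat.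
  move: tij => {fe}; case: i => i a; case: j => j a' /= tij; rewrite -tij in a' *.
  rewrite /pos/= => /eqP; rewrite eqn_add2l eqn_pmul2l ?double_gt0 ?cdv_size_gt0//.
  by move=> /eqP/val_inj ->; rewrite (ord1 l) (ord1 m).
- move=> i l j m; rewrite !rank_feat => tij _.
  by apply: val_inj; rewrite /= tij.
- by move=> i l; rewrite level_feat rank_feat; exact: level_besov.
- move=> i x; set w := `|_|; have bw0 : 0 <= beta * w.
    by apply: mulr_ge0; [exact: ltW beta_gt0 | exact: normr_ge0].
  rewrite -(@expr_le1 _ 2)// /w.
  rewrite exprMn real_normK ?num_real// beta2.
  have w2 := wavelet_sqr_le (level (feat i ord0)) (pos i) (tnth x (feat i ord0)).
  apply: (@le_trans _ _ (kappa ^+ 2 / n%:R * (M ^+ 2 * 2 ^+ h1 * n%:R))).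
    rewrite ler_wpM2l ?divr_ge0 ?sqr_ge0 ?(ltW n0)// (le_trans w2)// mulrC -mulrA.
    rewrite ler_wpM2l ?sqr_ge0// level_feat (le_trans (lev_le_v _))//.
    by rewrite ler_wpM2l ?exprn_ge0 ?v_len.
  rewrite (_ : _ * _ = kappa * (kappa * (M ^+ 2 * 2 ^+ h1))); last first.
    by field; rewrite gt_eqF.
  have kb : kappa * (M ^+ 2 * 2 ^+ h1) <= 1.
    by apply: le_trans kappa_K1; rewrite ler_wpM2l ?(ltW kappa_gt0).
  have kb0 : 0 <= kappa * (M ^+ 2 * 2 ^+ h1).
    by apply: mulr_ge0; [exact: ltW | rewrite mulr_ge0 ?sqr_ge0 ?exprn_ge0].
  by rewrite -[leRHS]mulr1 ler_pM ?(ltW kappa_gt0) ?kappa_le1.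
- move=> x; rewrite card_I natr_sum mulr_sumr.
  rewrite -(sig_big_dep xpredT (fun _ => xpredT) (fun j (a : 'I_(block_size j)) =>
    `|design_psi W feat level pos (Tagged (fun j => 'I_(block_size j)) a) ord0 x| ^+ 2))/=.
  apply: ler_sum => j _; apply: (@le_trans _ _ (2 ^+ lev j * M ^+ 2)).
    apply: sum_at_most_one => [|a|a a' aa'].
    - by rewrite mulr_ge0 ?sqr_ge0 ?exprn_ge0.
    - rewrite real_normK ?num_real// -(level_feat (Tagged _ a) ord0).
      exact: wavelet_sqr_le.
    - have := @disjoint_supports (lev j) (tnth x (widen_ord d0_le j)) a a' aa'.
      rewrite /design_psi/= /wavelet_feature.
      rewrite -(level_feat (Tagged (fun j => 'I_(block_size j)) a) ord0) /= /pos/=.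
      by case=> ->; [left|right]; rewrite normr0 expr0n.
  apply: (@le_trans _ _ (4 * N%:R * M ^+ 2 * (block_size j)%:R)).
    rewrite mulrAC ler_wpM2r ?sqr_ge0// -natrX.
    by have := size_large j; rewrite -(ler_nat R) 2!natrM.
  by rewrite ler_wpM2r ?K_ge4.
- apply: (@information_small _ n 1 kappa) => //; first exact: lt_le_trans K1.
  by rewrite beta2 mulr1 expRK; field; rewrite gt_eqF.
- apply: (@le_trans _ _ (kappa * (1 + 2 ^+ h1 * `|B|))); last first.
    have k0 : 0 < 64 * K by rewrite mulr_gt0// (lt_le_trans ltr01 K1).
    rewrite -div1r (ler_pdivlMr _ _ k0).
    by apply: le_trans kappa_B; rewrite le_eqVlt; apply/orP; left; apply/eqP; ring.
  have T0 : 0 <= 2 ^+ h1 * `|B| by rewrite mulr_ge0 ?exprn_ge0.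
  have U0 : 0 <= kappa * (1 + 2 ^+ h1 * `|B|).
    by apply: mulr_ge0; [exact: ltW | exact: addr_ge0].
  rewrite -[leRHS](ger0_norm U0) -sqrtr_sqr ler_sqrt ?sqr_ge0//.
  rewrite card_I natr_sum beta2 exprMn mulrC -mulrA ler_wpM2l ?sqr_ge0//.
  apply: (@le_trans _ _ (2 ^+ h1 * `|B|)); last by nra.
  apply: (@le_trans _ _ (2 ^+ h1 * \sum_j n%:R `^ (- (2 * s j / (2 * s j + 1))))).
    rewrite !mulr_sumr ler_sum// => j _.
    by rewrite -v_rate mulrC mulrA ler_pM2r ?invr_gt0.
  by rewrite ler_wpM2l ?exprn_ge0// (le_trans rate_le)// ler_norm.
Qed.

(** By [v_rate] each rate term is [v j / n], and [block_size] is at least a constant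
    times [v j]. *)
Lemma smooth_size :
  \sum_(j < d0) n%:R `^ (- (2 * s j / (2 * s j + 1))) <=
  8 * N%:R / kappa ^+ 2 * ((\sum_j block_size j)%N%:R * beta ^+ 2).
Proof.
rewrite beta2 natr_sum.
rewrite (_ : 8 * N%:R / kappa ^+ 2 * _ = \sum_j 8 * N%:R * (block_size j)%:R / n%:R).
  by apply: ler_sum => j _; rewrite -v_rate ler_pM2r ?invr_gt0.
rewrite -mulr_suml -mulr_sumr; field.
by rewrite !gt_eqF.
Qed.

End smooth.
End bounds.
End lower_bounds.

(** * Both terms of the rate *)

Theorem theorem3p7 (R : realType) (r : nat) (W : cdv_wavelets R r)
    (rho B : R) (hrho : 0 < rho) :
  exists C : R, 0 < C /\
  forall (n d d0 : nat) (s : 'I_d0 -> R) (p q : 'I_d0 -> \bar R)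
         (radius : 'I_d0 -> R),
    (1 <= d0 <= d)%N ->
    (forall j, (1 <= p j)%E) ->
    (forall j, (1 <= q j)%E) ->
    (forall j, Num.max (fine (p j)^-1%E - 2^-1) 0 < s j < r%:R) ->
    (forall j, rho <= radius j) ->
    d0%:R * ln (d%:R * expR 1 / d0%:R) <= n%:R :> R ->
    \sum_(j < d0) n%:R `^ (- (2 * s j / (2 * s j + 1))) <= B ->
    ((C * Num.sqrt (d0%:R * ln (d%:R * expR 1 / d0%:R) / n%:R +
                    \sum_(j < d0) n%:R `^ (- (2 * s j / (2 * s j + 1)))))%:E
       <= minimax_excess_risk W n d s p q radius)%E.
Proof.
have [M M1 M_le] := mother_bounded W.
set N := cdv_size W; set h1 := (cdv_coarse W).+1.
pose K : R := 4 * N%:R * M ^+ 2 * 2 ^+ h1.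
pose p2 : R := 2 `^ (h1%:R * (r%:R + 1)); pose b2 : R := 1 + 2 ^+ h1 * `|B|.
have N1 : 1 <= N%:R :> R by rewrite ler1n; exact: cdv_size_gt0.
have h11 : 1 <= 2 ^+ h1 :> R by rewrite exprn_ege1// ler1n.
have K1 : 1 <= K by rewrite /K !mulr_ege1// ?exprn_ege1// ler1n.
have p21 : 1 <= p2.
  by rewrite -[leLHS](powRr0 2) ler_powR ?ler1n// mulr_ge0// addr_ge0.
have b21 : 1 <= b2 by rewrite lerDl mulr_ge0// exprn_ge0.
have N0 : 0 < N%:R :> R by exact: lt_le_trans ltr01 N1.
have K0 : 0 < K by exact: lt_le_trans ltr01 K1.
have p20 : 0 < p2 by exact: lt_le_trans ltr01 p21.
have b20 : 0 < b2 by exact: lt_le_trans ltr01 b21.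
pose m := Num.min 1 rho; have m0 : 0 < m by rewrite lt_min ltr01.
have m1 : m <= 1 by rewrite ge_min lexx.
(* The factors of the denominator make, in this order, the information small,
   the wavelets of level [h1] small in the Besov norms, and [sigma] small in the
   smooth design. *)
pose kappa := m / (64 * K * p2 * b2).
have K64 : 0 < 64 * K by apply: mulr_gt0.
have D0 : 0 < 64 * K * p2 * b2 := mulr_gt0 (mulr_gt0 K64 p20) b20.
have kappa0 : 0 < kappa by rewrite divr_gt0.
have kE : 64 * K * kappa * p2 * b2 = m.
  by rewrite /kappa; field; rewrite !gt_eqF.
have kK0 : 0 < 64 * K * kappa := mulr_gt0 K64 kappa0.
have kKb : 64 * K * kappa * b2 <= 1.
  apply: le_trans m1; rewrite -kE [leRHS]mulrAC ler_peMr//.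
  exact: ltW (mulr_gt0 kK0 b20).
have kK : 64 * K * kappa <= 1.
  by apply: le_trans kKb; rewrite ler_peMr// ltW.
have krho : p2 * kappa <= Num.min 1 rho.
  rewrite -/m -kE.
  have : 1 * (p2 * kappa) * 1 <= (64 * K) * (p2 * kappa) * b2.
    have pk : 0 < p2 * kappa := mulr_gt0 p20 kappa0.
    apply: ler_pM => //; first by rewrite mul1r ltW.
    by rewrite ler_wpM2r ?(ltW pk)//; lra.
  by rewrite mulr1 mul1r => /le_trans; apply; rewrite le_eqVlt; apply/orP; left; apply/eqP; ring.
exists (kappa / (16 * N%:R) / (64 * K)).
split; first by rewrite !divr_gt0// mulr_gt0.
move=> n d d0 s p q radius /andP[d0_gt0 d0_le] p_ge1 q_ge1 s_max rho_le dn rate_le.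
have s_range j : 0 < s j < r%:R.
  have /andP[sj ->] := s_max j; rewrite andbT (le_lt_trans _ sj)//.
  by rewrite le_max lexx orbT.
have d0R : 0 < d0%:R :> R by rewrite ltr0n.
have ratio1 : 1 <= d%:R / d0%:R :> R by rewrite ler_pdivlMr// mul1r ler_nat.
have eE : d%:R * expR 1 / d0%:R = expR 1 * (d%:R / d0%:R) :> R by field; rewrite gt_eqF.
have ln1 : 1 <= ln (d%:R * expR 1 / d0%:R) :> R.
  by rewrite eE lnM ?posrE ?expR_gt0 ?(lt_le_trans ltr01 ratio1)// expRK lerDl ln_ge0.
have n_gt0 : (0 < n)%N.
  by rewrite -(ltr0n R) (lt_le_trans _ dn)// mulr_gt0// (lt_le_trans ltr01).
have nR : 0 < n%:R :> R by rewrite ltr0n.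
set L := (d %/ d0)%N; have L_gt0 : (0 < L)%N by rewrite divn_gt0.
have L1 : 1 <= L%:R :> R by rewrite ler1n.
have L_le : L%:R <= d%:R / d0%:R :> R.
  by rewrite ler_pdivlMr// -natrM ler_nat leq_divM.
have L_ge : d%:R / d0%:R <= 2 * L%:R :> R.
  rewrite ler_pdivrMr// -!natrM ler_nat.
  have := ltnW (ltn_ceil d d0_gt0); rewrite -/L mulSn => /leq_trans; apply.
  by rewrite -mulnA mul2n -addnn leq_add2r leq_pmull.
have e0 := expR_gt0 (1 : R).
have e2 : 2 <= expR 1 :> R by have := expR_ge1Dx (1 : R); lra.
have eL0 : 0 < expR 1 * L%:R :> R by apply: mulr_gt0 => //; exact: lt_le_trans ltr01 L1.
have er0 : 0 < expR 1 * (d%:R / d0%:R) :> R.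
  by apply: mulr_gt0 => //; exact: lt_le_trans ltr01 ratio1.
have ln_le : ln (expR 1 * L%:R) <= ln (d%:R * expR 1 / d0%:R) :> R.
  by rewrite eE ler_ln ?posrE// ler_pM2l.
have ln_ge : ln (d%:R * expR 1 / d0%:R) <= 2 * ln (expR 1 * L%:R) :> R.
  have -> : 2 * ln (expR 1 * L%:R) = ln ((expR 1 * L%:R) ^+ 2) :> R.
    by rewrite lnXn// mulr_natl.
  rewrite eE ler_ln ?posrE ?exprn_gt0//.
  apply: (@le_trans _ _ (expR 1 * (2 * L%:R))); first by rewrite ler_pM2l.
  rewrite expr2 -mulrA ler_pM2l//; move: (expR 1) (L%:R : R) e2 L1 => e l e2 l1.
  by nra.
have info : d0%:R * ln (expR 1 * L%:R) <= n%:R :> R.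
  by apply: le_trans dn; rewrite ler_pM2l.
have sparse := sparse_minimax M1 M_le kappa0 kK krho d0_gt0 d0_le n_gt0 p_ge1
  q_ge1 s_range rho_le hrho info.
have v1 j : 1 <= n%:R `^ (2 * s j + 1)^-1 :> R.
  have /andP[sj _] := s_range j.
  by rewrite -[leLHS](powRr0 n%:R) ler_powR ?ler1n// invr_ge0; lra.
pose lev j := resolution h1 (n%:R `^ (2 * s j + 1)^-1).
have levP j := resolution_bounds h1 (v1 j).
have lev1 j : (h1 <= lev j)%N by have [] := levP j.
have lev2 j : lev j = h1 \/ 2 ^+ lev j <= n%:R `^ (2 * s j + 1)^-1 by have [] := levP j.
have lev3 j : n%:R `^ (2 * s j + 1)^-1 <= 2 * 2 ^+ lev j by have [] := levP j.
have lev4 j : 2 ^+ lev j <= 2 ^+ h1 * n%:R `^ (2 * s j + 1)^-1 by have [] := levP j.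
have smooth := smooth_minimax M1 M_le kappa0 kK kKb krho d0_gt0 d0_le n_gt0 p_ge1
  q_ge1 s_range rho_le hrho lev1 lev2 lev4 rate_le.
have size := smooth_size kappa0 n_gt0 s_range lev1 lev3.
move: sparse smooth size; rewrite -/N -/K -/L.
set sA := d0%:R * _ ^+ 2; set sB := (\sum_(j < d0) _)%:R * _ ^+ 2.
set S := \sum_(j < d0) _; set a := _ / n%:R => sparse smooth size.
have sAE : sA = kappa ^+ 2 * (d0%:R * ln (expR 1 * L%:R) / n%:R).
  rewrite /sA exprMn sqr_sqrtr; last first.
    rewrite divr_ge0// ln_ge0// mulr_ege1//.
    by apply: le_trans e2; rewrite ler1n.
  by rewrite mulrCA !mulrA.
have k2 : 0 < kappa ^+ 2 by rewrite exprn_gt0.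
have a_le : a <= 8 * N%:R / kappa ^+ 2 * sA.
  have -> : 8 * N%:R / kappa ^+ 2 * sA =
      (4 * N%:R) * ((d0%:R * (2 * ln (expR 1 * L%:R))) / n%:R).
    by rewrite sAE; field; rewrite !gt_eqF.
  have a_le2 : a <= d0%:R * (2 * ln (expR 1 * L%:R)) / n%:R.
    by rewrite /a ler_pM2r ?invr_gt0// ler_pM2l.
  have a0 : 0 <= a by rewrite /a divr_ge0// mulr_ge0// (le_trans ler01).
  apply: (le_trans a_le2); rewrite ler_peMl ?(le_trans a0)//.
  by move: (N%:R : R) N1 => z; lra.
(* Whichever of the two variances dominates controls both terms. *)
have conclude (T : \bar R) (v : R) : a <= 8 * N%:R / kappa ^+ 2 * v ->
    S <= 8 * N%:R / kappa ^+ 2 * v -> ((Num.sqrt v / (64 * K))%:E <= T)%E ->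
    ((kappa / (16 * N%:R) / (64 * K) * Num.sqrt (a + S))%:E <= T)%E.
  move=> av Sv; apply: le_trans; rewrite lee_fin mulrAC ler_pM2r ?invr_gt0//.
  have c0 : 0 <= kappa / (16 * N%:R).
    by rewrite divr_ge0 ?(ltW kappa0)// ltW// mulr_gt0.
  rewrite -[kappa / _](ger0_norm c0) -sqrtr_sqr -sqrtrM ?sqr_ge0// ler_wsqrtr//.
  have aS : a + S <= 16 * N%:R / kappa ^+ 2 * v by lra.
  apply: (le_trans (ler_wpM2l (sqr_ge0 _) aS)).
  have -> : (kappa / (16 * N%:R)) ^+ 2 * (16 * N%:R / kappa ^+ 2 * v) =
      (16 * N%:R)^-1 * v by field; rewrite !gt_eqF.
  have v0 : 0 <= v.
    have a0 : 0 <= a by rewrite /a divr_ge0// mulr_ge0// (le_trans ler01).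
    have := le_trans a0 av; rewrite pmulr_rge0//.
    by rewrite divr_gt0// mulr_gt0.
  rewrite ler_piMl// invf_le1; first by move: (N%:R : R) N1 => z; lra.
  by rewrite mulr_gt0.
case: (lerP sA sB) => [AB|/ltW BA].
  apply: conclude size smooth; apply: (le_trans a_le).
  by rewrite ler_wpM2l// ltW// divr_gt0// mulr_gt0.
apply: conclude a_le _ sparse; apply: (le_trans size).
by rewrite ler_wpM2l// ltW// divr_gt0// mulr_gt0.
Qed.
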